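(* Let $n\ge 3$ and let $V(u,r)$ be a smooth compactly supported radially symmetric potential on $\mathbb{R}\times\mathbb{R}^n$ (depending on $u$ and $r=|x|$) satisfying $V''_{uu}(u,r)\le \frac{1}{4r^2}$ for all $u$ and $r>0$. For $A\in\mathbb{R}$ let $N_A$ be the set of all radial solutions $u(r)$, $r>0$, of $$u''+\frac{n-1}{r}u'+V'_u(u,r)=0$$ which, for some $\alpha\in\mathbb{R}$, satisfy $u(r)=\frac{\alpha}{r^{n-2}}+A$ for all $r$ outside the support of $V$ (i.e. for all sufficiently large $r$). Then for each $A$, the set $N_A$ is totally ordered (for any two distinct elements $u_1,u_2\in N_A$, either $u_1(r)<u_2(r)$ for all $r>0$ or $u_1(r)>u_2(r)$ for all $r>0$), and the graphs $\{(u(|x|),x): x\in\mathbb{R}^n\setminus\{0\}\}$ of the solutions in $N_A$ form a smooth foliation of $\mathbb{R}^{n+1}\setminus(\mathbb{R}\times\{0\})$, where $\mathbb{R}^{n+1}=\mathbb{R}(u)\times\mathbb{R}^n(x)$.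
   Context: The radial ODE is the equation satisfied by radially symmetric solutions $u(|x|)$ of $\Delta u=-V'_u(u,x)$. *)

(* Defs.v *)
From Stdlib Require Import Reals List.
From Coquelicot Require Import Coquelicot.
Open Scope R_scope.

Definition pd (b : bool) (F : R -> R -> R) : R -> R -> R :=
  if b then fun a c => Derive (fun t => F t c) a
  else fun a c => Derive (fun t => F a t) c.

Definition iter_pd (w : list bool) (F : R -> R -> R) : R -> R -> R :=
  fold_right pd F w.

Definition smooth_on (D : R -> R -> Prop) (F : R -> R -> R) : Prop :=
  forall (w : list bool) (a c : R), D a c ->
    ex_derive (fun t => iter_pd w F t c) a /\
    ex_derive (fun t => iter_pd w F a t) c /\
    continuity_2d_pt (iter_pd w F) a c.

(* V(u, r) is a smooth, compactly supported, radially symmetric potential on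
   R(u) x R^n(x): encoded as V : R -> R -> R, smooth on R x R, even in r
   (so that (u,x) |-> V u |x| is smooth on R x R^n, by Whitney's theorem),
   and vanishing outside a compact set. *)
Definition admissible_potential (V : R -> R -> R) : Prop :=
  smooth_on (fun _ _ => True) V /\
  (forall u r, V u (- r) = V u r) /\
  (exists K : R, forall u r, K < Rabs u \/ K < Rabs r -> V u r = 0).

Definition radial_solution (n : nat) (V : R -> R -> R) (u : R -> R) : Prop :=
  forall r, 0 < r ->
    ex_derive u r /\ ex_derive (Derive u) r /\
    Derive (Derive u) r + (INR n - 1) / r * Derive u r + pd true V (u r) r = 0.

Definition N_set (n : nat) (V : R -> R -> R) (A : R) (u : R -> R) : Prop :=
  radial_solution n V u /\
  exists alpha R0 : R, forall r, R0 < r -> u r = alpha / r ^ (n - 2) + A.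

(* Main.v *)
Require Import Defs.
From Stdlib Require Import Reals List Lra Lia.
From Coquelicot Require Import Coquelicot.
Open Scope R_scope.

(** Put [p = (n - 2) / 2], [r = rho exp (- t)] and [u = A + exp (p t) x], where [V]
    vanishes for [r >= rho]. The radial equation becomes [x'' = f (x, t)] with
    [f_x = p^2 - r^2 V''_uu >= p^2 - 1/4 >= 0], and [f = p^2 x] for [t <= 0]. Elements of
    [N_A] correspond to the solutions with [x = s exp (p t)] for [t <= 0], i.e. with
    [x 0 = s] and [x' 0 = p s]; they are global because [f] is Lipschitz in [x], locally
    uniformly in [t]. Their [s]-derivative [w] solves [w'' = f_x w] with [w 0 = 1] and
    [w' 0 = p], and is bounded below by a positive function of [t] alone because
    [f_x >= 0]: hence [x] is strictly increasing in [s] and takes every value.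
    Smoothness in [(s, t)] is a bootstrap: if [x] is C^k then so are the coefficients of
    the linear equation for [w], hence [w] is C^k and [x] is C^(k+1). *)

(** * Functions of class C^k of two variables *)

(** This is the Emden-Fowler substitution: [p = (n - 2) / 2] is exactly the exponent that removes
    the first-order term, and [r -> 0] is sent to [t -> + infinity], so that the singular origin
    becomes a question of global solvability in [t]. The solutions [r^-(n-2)] and [1] of the
    equation without potential turn into the modes [exp (p t)] and [exp (- p t)]; prescribing the
    constant [A] suppresses the second mode and leaves [s] as the only free parameter. The constant
    1/4 is the value of [p^2] in the smallest dimension [n = 3], that is, the Hardy constant there.
    Solutions cannot blow up because the compact support of [V] in [u] bounds [V''_uu] uniformly in
    [u] on every strip of bounded [r]. All estimates treat the scalar second-order equation
    directly, through an energy in the function and its derivative. The [s]-derivative is not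
    extracted from a limit: the linearised equation is solved beforehand, and its solution is then
    shown to approximate the increments to first order. *)

Fixpoint Ck (D : R -> R -> Prop) (k : nat) (F : R -> R -> R) : Prop :=
  (forall a c, D a c -> continuity_2d_pt F a c) /\
  match k with
  | O => True
  | S k' => exists Fa Fc : R -> R -> R,
      (forall a c, D a c -> is_derive (fun t => F t c) a (Fa a c)) /\
      (forall a c, D a c -> is_derive (fun t => F a t) c (Fc a c)) /\
      Ck D k' Fa /\ Ck D k' Fc
  end.

Definition everywhere (_ _ : R) : Prop := True.

Definition open_2d (D : R -> R -> Prop) : Prop :=
  forall a c, D a c -> locally_2d D a c.

Lemma open_2d_right_half : open_2d (fun _ c => 0 < c).
Proof.
  intros a c H. exists (mkposreal c H). simpl. intros u v _ Hv.
  apply Rabs_def2 in Hv. lra.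
Qed.

Lemma Ck_continuous D k F a c : Ck D k F -> D a c -> continuity_2d_pt F a c.
Proof. destruct k; simpl; intros [H _] Ha; auto. Qed.

Lemma Ck_pred D k F : Ck D (S k) F -> Ck D k F.
Proof.
  revert F; induction k as [|k IH]; intros F [Hc (Fa & Fc & H1 & H2 & H3 & H4)].
  - split; auto.
  - split; auto. exists Fa, Fc. split; [|split; [|split]]; auto; apply IH; assumption.
Qed.

Lemma Ck_ext D k F G : open_2d D ->
  (forall a c, D a c -> F a c = G a c) -> Ck D k F -> Ck D k G.
Proof.
  intros HD E.
  assert (L : forall a c, D a c -> locally_2d (fun x y => F x y = G x y) a c).
  { intros a c H. destruct (HD a c H) as [d Hd]. exists d. auto. }
  assert (C : (forall a c, D a c -> continuity_2d_pt F a c) ->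
              forall a c, D a c -> continuity_2d_pt G a c).
  { intros Hc a c H. apply continuity_2d_pt_ext_loc with F; auto. }
  destruct k; intros [Hc H]; split; auto.
  destruct H as (Fa & Fc & H1 & H2 & H3 & H4). exists Fa, Fc.
  split; [|split; [|split]]; auto; intros a c H.
  - apply is_derive_ext_loc with (fun t => F t c); auto.
    exact (locally_2d_1d_const_y _ _ _ (L a c H)).
  - apply is_derive_ext_loc with (fun t => F a t); auto.
    exact (locally_2d_1d_const_x _ _ _ (L a c H)).
Qed.

Lemma Ck_const D k x : Ck D k (fun _ _ => x).
Proof.
  revert x; induction k as [|k IH]; intros x; split; auto;
    try (intros; apply continuity_2d_pt_const).
  exists (fun _ _ => 0), (fun _ _ => 0).
  split; [|split; [|split]]; auto; intros;
    apply (is_derive_const (K := R_AbsRing) (V := R_NormedModule)).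
Qed.

Lemma Ck_fst D k : Ck D k (fun a _ => a).
Proof.
  destruct k; split; auto; try (intros; apply continuity_2d_pt_id1).
  exists (fun _ _ => 1), (fun _ _ => 0).
  split; [|split; [|split]]; auto using Ck_const; intros; auto_derive; auto.
Qed.

Lemma Ck_snd D k : Ck D k (fun _ c => c).
Proof.
  destruct k; split; auto; try (intros; apply continuity_2d_pt_id2).
  exists (fun _ _ => 0), (fun _ _ => 1).
  split; [|split; [|split]]; auto using Ck_const; intros; auto_derive; auto.
Qed.

Lemma Ck_plus D k F G : Ck D k F -> Ck D k G -> Ck D k (fun a c => F a c + G a c).
Proof.
  revert F G; induction k as [|k IH]; intros F G [HF HF'] [HG HG']; split; auto;
    try (intros; apply continuity_2d_pt_plus; auto).
  destruct HF' as (Fa & Fc & F1 & F2 & F3 & F4).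
  destruct HG' as (Ga & Gc & G1 & G2 & G3 & G4).
  exists (fun a c => Fa a c + Ga a c), (fun a c => Fc a c + Gc a c).
  split; [|split; [|split]]; auto; intros.
  - apply (is_derive_plus (fun t => F t c) (fun t => G t c)); auto.
  - apply (is_derive_plus (fun t => F a t) (fun t => G a t)); auto.
Qed.

Lemma is_derive_mult_R (f g : R -> R) x df dg :
  is_derive f x df -> is_derive g x dg ->
  is_derive (fun t => f t * g t) x (df * g x + f x * dg).
Proof. intros. apply (is_derive_mult f g); auto. intros; apply Rmult_comm. Qed.

Lemma Ck_mult D k F G : Ck D k F -> Ck D k G -> Ck D k (fun a c => F a c * G a c).
Proof.
  revert F G; induction k as [|k IH]; intros F G HF HG.
  - destruct HF, HG; split; auto. intros; apply continuity_2d_pt_mult; auto.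
  - assert (PF := Ck_pred _ _ _ HF). assert (PG := Ck_pred _ _ _ HG).
    destruct HF as [HF (Fa & Fc & F1 & F2 & F3 & F4)].
    destruct HG as [HG (Ga & Gc & G1 & G2 & G3 & G4)].
    split; [intros; apply continuity_2d_pt_mult; auto|].
    exists (fun a c => Fa a c * G a c + F a c * Ga a c),
           (fun a c => Fc a c * G a c + F a c * Gc a c).
    split; [|split; [|split]]; auto using Ck_plus; intros.
    + apply (is_derive_mult_R (fun t => F t c) (fun t => G t c)); auto.
    + apply (is_derive_mult_R (fun t => F a t) (fun t => G a t)); auto.
Qed.

(** Near the point, the increment in the first variable is controlled by the continuous partial
    [Fa]; the increment in the second is taken on the line through the point, where [Fc x y] is its
    derivative. *)
Lemma differentiable_pt_lim_of_partials (F Fa Fc : R -> R -> R) x y :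
  (forall a c, is_derive (fun t => F t c) a (Fa a c)) ->
  (forall a c, is_derive (fun t => F a t) c (Fc a c)) ->
  continuity_2d_pt Fa x y ->
  differentiable_pt_lim F x y (Fa x y) (Fc x y).
Proof.
  intros H1 H2 HC. apply filterdiff_differentiable_pt_lim.
  apply (is_derive_filterdiff F x y Fa (Fc x y)); auto.
  - now apply filter_forall.
  - now apply continuity_2d_pt_filterlim.
Qed.

Lemma is_derive_comp_2d (F Fa Fc : R -> R -> R) (g h : R -> R) x dg dh :
  (forall a c, is_derive (fun t => F t c) a (Fa a c)) ->
  (forall a c, is_derive (fun t => F a t) c (Fc a c)) ->
  continuity_2d_pt Fa (g x) (h x) ->
  is_derive g x dg -> is_derive h x dh ->
  is_derive (fun t => F (g t) (h t)) x (Fa (g x) (h x) * dg + Fc (g x) (h x) * dh).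
Proof.
  intros H1 H2 HC Hg Hh. apply is_derive_Reals.
  apply derivable_pt_lim_comp_2d; try (apply is_derive_Reals; assumption).
  apply differentiable_pt_lim_of_partials; auto.
Qed.

Lemma continuity_2d_pt_comp (F G H : R -> R -> R) a c :
  continuity_2d_pt F (G a c) (H a c) ->
  continuity_2d_pt G a c -> continuity_2d_pt H a c ->
  continuity_2d_pt (fun x y => F (G x y) (H x y)) a c.
Proof.
  intros HF HG HH eps. destruct (HF eps) as [d Hd].
  destruct (HG d) as [d1 H1], (HH d) as [d2 H2].
  assert (Hm : 0 < Rmin d1 d2) by (apply Rmin_pos; apply cond_pos).
  exists (mkposreal _ Hm); simpl. intros u v Hu Hv.
  assert (Rmin d1 d2 <= d1) by apply Rmin_l. assert (Rmin d1 d2 <= d2) by apply Rmin_r.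
  apply Hd; [apply H1|apply H2]; lra.
Qed.

Lemma Ck_comp D k F G H : Ck everywhere k F -> Ck D k G -> Ck D k H ->
  Ck D k (fun a c => F (G a c) (H a c)).
Proof.
  revert F G H; induction k as [|k IH]; intros F G H HF HG HH.
  - destruct HF as [HF _], HG as [HG _], HH as [HH _]; split; auto.
    intros; apply continuity_2d_pt_comp; auto. now apply HF.
  - assert (PG := Ck_pred _ _ _ HG). assert (PH := Ck_pred _ _ _ HH).
    destruct HF as [HF (Fa & Fc & F1 & F2 & F3 & F4)].
    destruct HG as [HG (Ga & Gc & G1 & G2 & G3 & G4)].
    destruct HH as [HH (Ha & Hc & H1 & H2 & H3 & H4)].
    assert (CFa : forall a c, continuity_2d_pt Fa a c)
      by (intros; apply (Ck_continuous _ _ _ _ _ F3 I)).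
    split; [intros; apply continuity_2d_pt_comp; auto; now apply HF|].
    exists (fun a c => Fa (G a c) (H a c) * Ga a c + Fc (G a c) (H a c) * Ha a c),
           (fun a c => Fa (G a c) (H a c) * Gc a c + Fc (G a c) (H a c) * Hc a c).
    split; [|split; [|split]]; try (apply Ck_plus; apply Ck_mult; auto); intros.
    + apply (is_derive_comp_2d F Fa Fc (fun t => G t c) (fun t => H t c)); auto;
        intros; [apply F1|apply F2]; exact I.
    + apply (is_derive_comp_2d F Fa Fc (fun t => G a t) (fun t => H a t)); auto;
        intros; [apply F1|apply F2]; exact I.
Qed.

Lemma Ck_exp D k F : Ck D k F -> Ck D k (fun a c => exp (F a c)).
Proof.
  intros HF. apply (Ck_comp D k (fun a _ => exp a) F F); auto. clear.
  induction k as [|k IH].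
  - split; auto. intros. apply (continuity_1d_2d_pt_comp exp (fun a _ => a)).
    + apply derivable_continuous_pt, derivable_pt_exp.
    + apply continuity_2d_pt_id1.
  - split; [intros; apply (Ck_continuous _ _ _ _ _ IH I)|].
    exists (fun a _ => exp a), (fun _ _ => 0).
    split; [|split; [|split]]; auto using Ck_const; intros.
    + apply is_derive_exp.
    + apply (is_derive_const (K := R_AbsRing) (V := R_NormedModule)).
Qed.

Lemma Ck_inv_snd k : Ck (fun _ c => 0 < c) k (fun _ c => / c).
Proof.
  assert (C : forall a c, 0 < c -> continuity_2d_pt (fun _ c => / c) a c).
  { intros a c Hc. apply continuity_2d_pt_inv; [apply continuity_2d_pt_id2|lra]. }
  induction k as [|k IH]; split; auto.
  exists (fun _ _ => 0), (fun _ c => (-1) * (/ c * / c)).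
  split; [|split; [|split]]; auto using Ck_const, Ck_mult; intros; auto_derive; auto; try lra.
  field; lra.
Qed.

Lemma Ck_ln_snd k : Ck (fun _ c => 0 < c) k (fun _ c => ln c).
Proof.
  destruct k; (split; [intros a c Hc; apply (continuity_1d_2d_pt_comp ln (fun _ c => c));
    [apply derivable_continuous_pt; exists (/ c); now apply derivable_pt_lim_ln
    |apply continuity_2d_pt_id2] | auto]).
  exists (fun _ _ => 0), (fun _ c => / c).
  split; [|split; [|split]]; auto using Ck_const, Ck_inv_snd; intros; auto_derive; auto; try lra.
Qed.

Lemma Ck_iter_pd_of_smooth D V : smooth_on D V -> forall k w, Ck D k (iter_pd w V).
Proof.
  intros HV k; induction k as [|k IH]; intros w.
  - split; auto. intros a c H. apply HV; auto.
  - split; [intros a c H; apply HV; auto|].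
    exists (iter_pd (true :: w) V), (iter_pd (false :: w) V).
    split; [|split; [|split; apply IH]]; intros a c H;
      apply Derive_correct; apply (HV w a c H).
Qed.

(** [Ck] carries its partial derivatives as witnesses, which suits sums, products and the chain
    rule. Here they are identified with [Derive]; this needs [D] open, since equality must hold near
    a point to pass to derivatives. Each letter of [w] costs one order, hence the claim for all [k]
    at once. *)
Lemma smooth_of_Ck D F : open_2d D -> (forall k, Ck D k F) -> smooth_on D F.
Proof.
  intros HD HF.
  assert (P : forall w k, Ck D k (iter_pd w F)).
  { induction w as [|b w IH]; intros k; [apply HF|].
    destruct (IH (S k)) as [_ (Fa & Fc & H1 & H2 & H3 & H4)].
    destruct b; [apply (Ck_ext D k Fa)|apply (Ck_ext D k Fc)]; auto; intros a c H;
      symmetry; simpl; apply is_derive_unique; auto. }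
  intros w a c H. destruct (P w 1%nat) as [Hc (Fa & Fc & H1 & H2 & _)].
  split; [|split]; auto; eexists; auto.
Qed.

(** * Second-order scalar equations: a priori bounds and global existence *)

Lemma continuity_pt_of_is_derive (f : R -> R) x l : is_derive f x l -> continuity_pt f x.
Proof.
  intros H. apply continuity_pt_filterlim.
  apply (ex_derive_continuous f). now exists l.
Qed.

Lemma is_derive_MVT (f f1 : R -> R) a b :
  (forall t, Rmin a b <= t <= Rmax a b -> is_derive f t (f1 t)) ->
  exists c, Rmin a b <= c <= Rmax a b /\ f b - f a = f1 c * (b - a).
Proof.
  intros H. apply MVT_gen; intros; [apply H; lra|].
  eapply continuity_pt_of_is_derive, H; auto.
Qed.

Lemma between_Rabs a b c : Rmin a b <= c <= Rmax a b -> Rabs (c - a) <= Rabs (b - a).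
Proof.
  unfold Rmin, Rmax. destruct (Rle_dec a b); intros;
    unfold Rabs; destruct (Rcase_abs (c - a)), (Rcase_abs (b - a)); lra.
Qed.

Lemma bounded_of_continuity (h : R -> R) M :
  (forall t, continuity_pt h t) -> exists B, 0 <= B /\ forall t, Rabs t <= M -> Rabs (h t) <= B.
Proof.
  intros Hc. destruct (Rle_lt_dec 0 M) as [HM|HM].
  - destruct (continuity_ab_maj (fun t => Rabs (h t)) (- M) M) as [m [Hm _]]; [lra| |].
    + intros; apply (continuity_pt_comp h Rabs); auto. apply Rcontinuity_abs.
    + exists (Rabs (h m)). split; [apply Rabs_pos|].
      intros t Ht. apply Hm. now apply Rabs_le_between.
  - exists 0. split; [lra|]. intros t Ht. assert (P := Rabs_pos t). lra.
Qed.

(** With [x = |e|] and [y = |e1|], the three products [2 x y], [2 L x y] and [2 y eps] are each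
    split by [2 a b <= a^2 + b^2]; the square [y^2] then occurs [2 + L] times, the largest count.
    Putting [eps^2] into the energy absorbs the source term. *)
Lemma energy_derivative_bound e e1 e2 L eps :
  0 <= L -> Rabs e2 <= L * Rabs e + eps ->
  Rabs (2 * e * e1 + 2 * e1 * e2) <= (2 + L) * (e ^ 2 + e1 ^ 2 + eps ^ 2).
Proof.
  intros HL H.
  assert (T : Rabs (2 * e * e1 + 2 * e1 * e2)
              <= 2 * Rabs e * Rabs e1 + 2 * Rabs e1 * Rabs e2).
  { eapply Rle_trans; [apply Rabs_triang|].
    rewrite !Rabs_mult, (Rabs_pos_eq 2) by lra. lra. }
  rewrite <- (pow2_abs e), <- (pow2_abs e1).
  revert H T. generalize (Rabs_pos e) (Rabs_pos e1).
  generalize (Rabs e) (Rabs e1). intros x y Hx Hy H T.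
  assert (y * Rabs e2 <= y * (L * x + eps)) by (apply Rmult_le_compat_l; auto).
  assert (0 <= L * (x - y) ^ 2) by (apply Rmult_le_pos; auto; apply pow2_ge_0).
  assert (0 <= L * eps ^ 2) by (apply Rmult_le_pos; auto; apply pow2_ge_0).
  assert (Z1 := pow2_ge_0 (x - y)). assert (Z2 := pow2_ge_0 (y - eps)).
  assert (Z3 := pow2_ge_0 x). assert (Z4 := pow2_ge_0 eps). lra.
Qed.

(* The energy [E = e^2 + e1^2 + eps^2] satisfies [|E'| <= (2 + L) E]. *)
Lemma gronwall_segment (e e1 e2 : R -> R) t0 t M L eps :
  0 <= L -> 0 <= eps -> Rabs (t - t0) <= M ->
  (forall s, Rmin t0 t <= s <= Rmax t0 t -> is_derive e s (e1 s)) ->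
  (forall s, Rmin t0 t <= s <= Rmax t0 t -> is_derive e1 s (e2 s)) ->
  (forall s, Rmin t0 t <= s <= Rmax t0 t -> Rabs (e2 s) <= L * Rabs (e s) + eps) ->
    Rabs (e t) <= (Rabs (e t0) + Rabs (e1 t0) + eps) * exp ((2 + L) * M) /\
    Rabs (e1 t) <= (Rabs (e t0) + Rabs (e1 t0) + eps) * exp ((2 + L) * M).
Proof.
  intros HL Heps Ht H1 H2 H3.
  set (lam := 2 + L). set (E := fun s => e s ^ 2 + e1 s ^ 2 + eps ^ 2).
  assert (HE : forall s, Rmin t0 t <= s <= Rmax t0 t -> forall sg,
     is_derive (fun s => E s * exp (- sg * lam * (s - t0))) s
     ((2 * e s * e1 s + 2 * e1 s * e2 s - sg * lam * E s) * exp (- sg * lam * (s - t0)))).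
  { intros s Hs sg. unfold E. specialize (H1 s Hs). specialize (H2 s Hs).
    auto_derive; [split; [now exists (e1 s)|split; [now exists (e2 s)|auto]]|].
    replace (Derive (fun x : R => e x) s) with (e1 s) by (symmetry; now apply is_derive_unique).
    replace (Derive (fun x : R => e1 x) s) with (e2 s) by (symmetry; now apply is_derive_unique).
    unfold Rminus. ring. }
  (* The sign [sg] is the direction of time from [t0] to [t]; in that direction
     [E s * exp (- sg * lam * (s - t0))] does not increase. *)
  assert (G : forall sg, sg * sg = 1 -> t - t0 = sg * Rabs (t - t0) ->
                E t <= E t0 * exp (lam * M)).
  { intros sg Hsg Hd.
    destruct (is_derive_MVT _ _ t0 t (fun s Hs => HE s Hs sg))
      as [c [Hc Q]].
    assert (B := energy_derivative_bound (e c) (e1 c) (e2 c) L eps HL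
                   (H3 c Hc)).
    fold lam in B. change (e c ^ 2 + e1 c ^ 2 + eps ^ 2) with (E c) in B.
    rewrite Rminus_diag, Rmult_0_r, exp_0, Rmult_1_r in Q.
    assert (S : sg * (2 * e c * e1 c + 2 * e1 c * e2 c - sg * lam * E c) <= 0).
    { replace (sg * (2 * e c * e1 c + 2 * e1 c * e2 c - sg * lam * E c))
        with (sg * (2 * e c * e1 c + 2 * e1 c * e2 c) - sg * sg * (lam * E c)) by ring.
      rewrite Hsg. apply Rabs_le_between in B.
      assert (C : sg = 1 \/ sg = -1).
      { assert (Z : (sg - 1) * (sg + 1) = 0) by lra.
        apply Rmult_integral in Z. destruct Z; [left|right]; lra. }
      destruct C as [-> | ->]; lra. }
    assert (W : E t * exp (- sg * lam * (t - t0)) <= E t0).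
    { rewrite Hd in Q at 2.
      assert (P := exp_pos (- sg * lam * (c - t0))).
      assert (P' := Rabs_pos (t - t0)).
      assert (0 <= exp (- sg * lam * (c - t0)) * Rabs (t - t0)) by nra.
      nra. }
    replace (- sg * lam * (t - t0)) with (- (lam * Rabs (t - t0))) in W
      by (rewrite Hd at 2; replace (- sg * lam * (sg * Rabs (t - t0)))
             with (- (sg * sg * lam * Rabs (t - t0))) by ring; rewrite Hsg; ring).
    assert (X : exp (lam * Rabs (t - t0)) <= exp (lam * M)).
    { destruct (Rle_lt_or_eq_dec _ _ Ht) as [l|l].
      - left. apply exp_increasing, Rmult_lt_compat_l; auto. unfold lam; lra.
      - right. now rewrite l. }
    rewrite exp_Ropp in W.
    assert (P := exp_pos (lam * Rabs (t - t0))).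
    assert (N : 0 <= E t0) by (unfold E; assert (Z1 := pow2_ge_0 (e t0));
      assert (Z2 := pow2_ge_0 (e1 t0)); assert (Z3 := pow2_ge_0 eps); lra).
    apply Rle_trans with (E t0 * exp (lam * Rabs (t - t0))).
    - replace (E t) with (E t * / exp (lam * Rabs (t - t0)) * exp (lam * Rabs (t - t0)))
        by (field; lra).
      apply Rmult_le_compat_r; lra.
    - apply Rmult_le_compat_l; auto. }
  assert (K : E t <= E t0 * exp (lam * M)).
  { destruct (Rle_lt_dec 0 (t - t0)).
    - apply (G 1); [ring|]. rewrite Rabs_pos_eq; lra.
    - apply (G (-1)); [ring|]. rewrite Rabs_left; lra. }
  assert (HX : 1 <= exp (lam * M)).
  { rewrite <- exp_0. assert (0 <= M) by (eapply Rle_trans; [apply Rabs_pos|exact Ht]).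
    destruct (Rle_lt_or_eq_dec 0 (lam * M)) as [l|l].
    - apply Rmult_le_pos; auto. unfold lam; lra.
    - left. now apply exp_increasing.
    - right. now rewrite l. }
  fold lam. revert K HX. generalize (exp (lam * M)). intros X K HX.
  unfold E in K. rewrite <- (pow2_abs (e t0)), <- (pow2_abs (e1 t0)) in K.
  assert (P0 := Rabs_pos (e t0)). assert (P1 := Rabs_pos (e1 t0)).
  set (S := Rabs (e t0) + Rabs (e1 t0) + eps).
  (* The energy bound gives the factor [sqrt X]; since [X >= 1] it is weakened to [X], which avoids
     square roots. *)
  assert (KS : e t ^ 2 + e1 t ^ 2 <= (S * X) ^ 2).
  { apply Rle_trans with (S ^ 2 * X).
    - apply Rle_trans with ((Rabs (e t0) ^ 2 + Rabs (e1 t0) ^ 2 + eps ^ 2) * X).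
      + assert (Z := pow2_ge_0 eps). lra.
      + apply Rmult_le_compat_r; [lra|]. unfold S. nra.
    - assert (Z := pow2_ge_0 S). rewrite Rpow_mult_distr.
      apply Rmult_le_compat_l; auto. nra. }
  assert (HS : 0 <= S * X) by (apply Rmult_le_pos; unfold S; lra).
  assert (Z1 := pow2_ge_0 (e t)). assert (Z2 := pow2_ge_0 (e1 t)).
  split; rewrite <- (Rabs_pos_eq (S * X)) by auto; apply Rsqr_le_abs_0;
    rewrite !Rsqr_pow2; lra.
Qed.

Lemma gronwall_second_order (e e1 e2 : R -> R) t0 M L eps :
  0 <= L -> 0 <= eps ->
  (forall t, Rabs (t - t0) <= M -> is_derive e t (e1 t)) ->
  (forall t, Rabs (t - t0) <= M -> is_derive e1 t (e2 t)) ->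
  (forall t, Rabs (t - t0) <= M -> Rabs (e2 t) <= L * Rabs (e t) + eps) ->
  forall t, Rabs (t - t0) <= M ->
    Rabs (e t) <= (Rabs (e t0) + Rabs (e1 t0) + eps) * exp ((2 + L) * M) /\
    Rabs (e1 t) <= (Rabs (e t0) + Rabs (e1 t0) + eps) * exp ((2 + L) * M).
Proof.
  intros HL Heps H1 H2 H3 t Ht.
  assert (B : forall s, Rmin t0 t <= s <= Rmax t0 t -> Rabs (s - t0) <= M)
    by (intros s Hs; apply between_Rabs in Hs; lra).
  apply (gronwall_segment e e1 e2); auto.
Qed.

(** A convex function is minimal at its critical point: the mean value theorem applied twice gives
    [f t - f 0 = f2 d * (c * t)], where [c] lies between [0] and [t], so [c * t >= 0]. *)
Lemma ge_initial_of_convex (f f1 f2 : R -> R) M :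
  (forall t, Rabs t <= M -> is_derive f t (f1 t)) ->
  (forall t, Rabs t <= M -> is_derive f1 t (f2 t)) ->
  (forall t, Rabs t <= M -> 0 <= f2 t) -> f1 0 = 0 ->
  forall t, Rabs t <= M -> f 0 <= f t.
Proof.
  intros H1 H2 H3 H0 t Ht.
  assert (A : forall s, Rmin 0 t <= s <= Rmax 0 t -> Rabs s <= Rabs t).
  { intros s Hs. apply between_Rabs in Hs. now rewrite !Rminus_0_r in Hs. }
  destruct (is_derive_MVT f f1 0 t) as [c [Hc E]].
  { intros s Hs. apply H1. specialize (A s Hs). lra. }
  assert (Rc := A c Hc).
  destruct (is_derive_MVT f1 f2 0 c) as [d [Hd E']].
  { intros s Hs. apply H2. apply between_Rabs in Hs. rewrite !Rminus_0_r in Hs. lra. }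
  assert (Q : 0 <= f2 d).
  { apply H3. apply between_Rabs in Hd. rewrite !Rminus_0_r in Hd. lra. }
  rewrite H0 in E'.
  assert (0 <= c * t).
  { revert Hc. unfold Rmin, Rmax. destruct (Rle_dec 0 t); intros; nra. }
  replace (f1 c) with (f2 d * c) in E by lra.
  assert (0 <= f2 d * (c * t)) by (apply Rmult_le_pos; auto). lra.
Qed.

Lemma cosh_ge_1 x : 1 <= cosh x.
Proof.
  unfold cosh. assert (P := exp_pos x).
  assert (Q : exp x * exp (- x) = 1) by (rewrite <- exp_plus, Rplus_opp_r; apply exp_0).
  assert (P' := exp_pos (- x)).
  assert (0 <= (exp x - 1) ^ 2 * exp (- x))
    by (apply Rmult_le_pos; [apply pow2_ge_0|lra]).
  replace ((exp x - 1) ^ 2 * exp (- x))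
    with (exp x * (exp x * exp (- x)) - 2 * (exp x * exp (- x)) + exp (- x)) in H by ring.
  rewrite Q in H. lra.
Qed.

(** Both [B / lam^2 cosh (lam t) + f] and [B / lam^2 cosh (lam t) - f] are convex with a critical
    point at 0. So integrating twice against the weight [cosh (lam t)] gains the factor [1 / lam^2],
    which makes the Picard map a contraction on an interval of any length. *)
Lemma cosh_comparison (f f1 f2 : R -> R) M lam B :
  0 < lam -> 0 <= B ->
  (forall t, Rabs t <= M -> is_derive f t (f1 t)) ->
  (forall t, Rabs t <= M -> is_derive f1 t (f2 t)) ->
  (forall t, Rabs t <= M -> Rabs (f2 t) <= B * cosh (lam * t)) -> f 0 = 0 -> f1 0 = 0 ->
  forall t, Rabs t <= M -> Rabs (f t) <= B / lam ^ 2 * cosh (lam * t).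
Proof.
  intros Hl HB H1 H2 H3 H0 H0' t Ht.
  assert (Cs : forall s, is_derive (fun s => B / lam ^ 2 * cosh (lam * s)) s
                                 (B / lam * sinh (lam * s))).
  { intros s. unfold cosh, sinh. auto_derive; auto. field. lra. }
  assert (Ss : forall s, is_derive (fun s => B / lam * sinh (lam * s)) s (B * cosh (lam * s))).
  { intros s. unfold cosh, sinh. auto_derive; auto. field. lra. }
  assert (P : 0 <= B / lam ^ 2) by (apply Rdiv_le_0_compat; auto; now apply pow_lt).
  assert (Z : sinh (lam * 0) = 0) by (rewrite Rmult_0_r; apply sinh_0).
  assert (Z' : cosh (lam * 0) = 1) by (rewrite Rmult_0_r; apply cosh_0).
  apply Rabs_le. split.
  - assert (K := ge_initial_of_convex (fun s => B / lam ^ 2 * cosh (lam * s) + f s)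
      (fun s => B / lam * sinh (lam * s) + f1 s) (fun s => B * cosh (lam * s) + f2 s) M).
    cut (B / lam ^ 2 * cosh (lam * 0) + f 0 <= B / lam ^ 2 * cosh (lam * t) + f t).
    { rewrite Z', H0. lra. }
    apply K; auto; intros.
    + apply (is_derive_plus (fun s => B / lam ^ 2 * cosh (lam * s)) f); auto.
    + apply (is_derive_plus (fun s => B / lam * sinh (lam * s)) f1); auto.
    + specialize (H3 t0 H). apply Rabs_le_between in H3. lra.
    + rewrite Z, H0'. ring.
  - assert (K := ge_initial_of_convex (fun s => B / lam ^ 2 * cosh (lam * s) - f s)
      (fun s => B / lam * sinh (lam * s) - f1 s) (fun s => B * cosh (lam * s) - f2 s) M).
    cut (B / lam ^ 2 * cosh (lam * 0) - f 0 <= B / lam ^ 2 * cosh (lam * t) - f t).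
    { rewrite Z', H0. lra. }
    apply K; auto; intros.
    + apply (is_derive_minus (fun s => B / lam ^ 2 * cosh (lam * s)) f); auto.
    + apply (is_derive_minus (fun s => B / lam * sinh (lam * s)) f1); auto.
    + specialize (H3 t0 H). apply Rabs_le_between in H3. lra.
    + rewrite Z, H0'. ring.
Qed.

(** * Picard iteration for second-order equations *)

Lemma is_derive_RInt_continuity (h : R -> R) t :
  (forall s, continuity_pt h s) -> is_derive (fun t => RInt h 0 t) t (h t).
Proof.
  intros Hc.
  assert (C : forall s, continuous h s) by (intros; now apply continuity_pt_filterlim).
  apply (is_derive_RInt h (fun t => RInt h 0 t) 0); auto.
  apply filter_forall. intros s. apply (RInt_correct h).
  apply (ex_RInt_continuous h). auto.
Qed.

(** The solution of [y'' = h] with [y 0 = x0] and [y' 0 = x1]; a fixed point of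
    [x |-> double_primitive x0 x1 (F x)] solves the nonlinear equation. *)
Definition double_primitive (x0 x1 : R) (h : R -> R) (t : R) : R :=
  x0 + x1 * t + RInt (fun s => RInt h 0 s) 0 t.

Lemma is_derive_double_primitive x0 x1 h t : (forall s, continuity_pt h s) ->
  is_derive (double_primitive x0 x1 h) t (x1 + RInt h 0 t).
Proof.
  intros Hc. unfold double_primitive.
  apply (is_derive_plus (fun t => x0 + x1 * t)).
  - auto_derive; auto. ring.
  - apply (is_derive_RInt_continuity (fun s => RInt h 0 s)).
    intros s. eapply continuity_pt_of_is_derive. now apply is_derive_RInt_continuity.
Qed.

Lemma is_derive_primitive_plus x1 h t : (forall s, continuity_pt h s) ->
  is_derive (fun t => x1 + RInt h 0 t) t (h t).
Proof.
  intros Hc. rewrite <- (Rplus_0_l (h t)).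
  apply (is_derive_plus (fun _ => x1) (fun t => RInt h 0 t)).
  - apply (is_derive_const (K := R_AbsRing) (V := R_NormedModule)).
  - now apply is_derive_RInt_continuity.
Qed.

Lemma RInt_0_0 (h : R -> R) : RInt h 0 0 = 0.
Proof. apply (RInt_point 0 h). Qed.

Lemma double_primitive_0 x0 x1 h : double_primitive x0 x1 h 0 = x0.
Proof. unfold double_primitive. rewrite RInt_0_0. ring. Qed.

Lemma geometric_eventually_small C eps : 0 <= C -> 0 < eps ->
  exists N, forall k, (N <= k)%nat -> C * (/ 2) ^ k < eps.
Proof.
  intros HC Heps.
  assert (G : is_lim_seq (fun k => C * (/ 2) ^ k) 0).
  { replace (Finite 0) with (Rbar_mult C 0) by (simpl; f_equal; ring).
    apply is_lim_seq_scal_l, is_lim_seq_geom. rewrite Rabs_pos_eq; lra. }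
  apply is_lim_seq_spec in G. destruct (G (mkposreal eps Heps)) as [N HN].
  exists N. intros k Hk. specialize (HN k Hk). simpl in HN.
  rewrite Rminus_0_r in HN. apply Rabs_def2 in HN. lra.
Qed.

Lemma geometric_cauchy_limit (u : nat -> R) C : 0 <= C ->
  (forall k, Rabs (u (S k) - u k) <= C * (/ 2) ^ k) ->
  is_lim_seq u (real (Lim_seq u)) /\
  forall k, Rabs (real (Lim_seq u) - u k) <= 2 * C * (/ 2) ^ k.
Proof.
  intros HC H.
  assert (P : forall k, 0 <= (/ 2) ^ k) by (intros; apply pow_le; lra).
  (* The exact geometric remainder is kept because the induction on [j] does not close on the bound
     [2 * C * (/ 2) ^ k] alone. *)
  assert (T : forall j k, Rabs (u (k + j)%nat - u k) <= 2 * C * ((/ 2) ^ k - (/ 2) ^ (k + j))).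
  { induction j as [|j IH]; intros k.
    - rewrite Nat.add_0_r, !Rminus_diag, Rabs_R0. lra.
    - rewrite Nat.add_succ_r.
      replace (u (S (k + j)) - u k)
        with ((u (S (k + j)) - u (k + j)%nat) + (u (k + j)%nat - u k)) by ring.
      eapply Rle_trans; [apply Rabs_triang|].
      specialize (IH k). specialize (H (k + j)%nat).
      change ((/ 2) ^ S (k + j)) with (/ 2 * (/ 2) ^ (k + j)). lra. }
  assert (T' : forall j k, Rabs (u (k + j)%nat - u k) <= 2 * C * (/ 2) ^ k).
  { intros j k. eapply Rle_trans; [apply T|].
    apply Rmult_le_compat_l; [lra|]. specialize (P (k + j)%nat). lra. }
  assert (F : ex_finite_lim_seq u).
  { apply ex_lim_seq_cauchy_corr. intros eps.
    destruct (geometric_eventually_small (4 * C) eps) as [N HN]; [lra|apply cond_pos|].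
    exists N. intros n m Hn Hm.
    apply Rle_lt_trans with (2 := HN N (Nat.le_refl N)).
    replace (u n - u m) with ((u n - u N) - (u m - u N)) by ring.
    eapply Rle_trans; [apply Rabs_triang|]. rewrite Rabs_Ropp.
    assert (A := T' (n - N)%nat N). assert (B := T' (m - N)%nat N).
    replace (N + (n - N))%nat with n in A by lia.
    replace (N + (m - N))%nat with m in B by lia. lra. }
  assert (L := Lim_seq_correct' u F). split; auto.
  intros k.
  assert (L' : is_lim_seq (fun j => Rabs (u (k + j)%nat - u k)) (Rabs (real (Lim_seq u) - u k))).
  { apply (is_lim_seq_abs (fun j => u (k + j)%nat - u k) (Finite (Lim_seq u - u k))).
    apply is_lim_seq_minus'; [|apply is_lim_seq_const].
    apply is_lim_seq_ext with (fun j => u (j + k)%nat); [intros; f_equal; lia|].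
    now apply is_lim_seq_incr_n. }
  apply (is_lim_seq_le _ _ _ _ (fun j => T' j k) L' (is_lim_seq_const _)).
Qed.

Definition locally_lipschitz_fst (F : R -> R -> R) : Prop :=
  forall M, exists L, 0 <= L /\
    forall x y t, Rabs t <= M -> Rabs (F x t - F y t) <= L * Rabs (x - y).

(** The iteration starts from the affine function with the prescribed data, written as the double
    primitive of 0, so that any two iterates are double primitives with the same data and a single
    estimate covers all differences. *)
Fixpoint picard (F : R -> R -> R) (x0 x1 : R) (k : nat) : R -> R :=
  double_primitive x0 x1
    (match k with
     | O => fun _ => 0
     | S k' => fun s => F (picard F x0 x1 k' s) s
     end).

Definition ode_sol (F : R -> R -> R) (x0 x1 t : R) : R :=
  real (Lim_seq (fun k => picard F x0 x1 k t)).

Definition ode_dsol (F : R -> R -> R) (x0 x1 t : R) : R :=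
  x1 + RInt (fun s => F (ode_sol F x0 x1 s) s) 0 t.

Section Picard.
Variable F : R -> R -> R.
Hypothesis F_cont : forall x t, continuity_2d_pt F x t.
Hypothesis F_lip : locally_lipschitz_fst F.
Variables x0 x1 : R.

Lemma continuity_pt_along (h : R -> R) :
  (forall s, continuity_pt h s) -> forall s, continuity_pt (fun s => F (h s) s) s.
Proof.
  intros Hh s. intros eps Heps.
  destruct (F_cont (h s) s (mkposreal eps Heps)) as [d Hd].
  destruct (Hh s d (cond_pos d)) as [d' [Pd' Hd']].
  exists (Rmin d d'). split; [apply Rmin_pos; auto; apply cond_pos|].
  intros y [Hy Hy']. simpl in *. unfold R_dist in *.
  assert (Rmin d d' <= d) by apply Rmin_l. assert (Rmin d d' <= d') by apply Rmin_r.
  apply Hd; [apply Hd'; split; auto; lra|lra].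
Qed.

Let rhs k := match k with O => fun _ => 0 | S k' => fun s => F (picard F x0 x1 k' s) s end.

Lemma picard_continuity k : forall t, continuity_pt (picard F x0 x1 k) t.
Proof.
  induction k as [|k IH]; intros t;
    eapply continuity_pt_of_is_derive; apply is_derive_double_primitive.
  - intros s. now apply continuity_pt_const.
  - now apply continuity_pt_along.
Qed.

Lemma rhs_continuity k : forall t, continuity_pt (rhs k) t.
Proof.
  destruct k; intros t; [now apply continuity_pt_const|].
  apply (continuity_pt_along (picard F x0 x1 k)), picard_continuity.
Qed.

Lemma double_primitive_difference (g h : R -> R) M lam B :
  0 < lam -> 0 <= B ->
  (forall s, continuity_pt g s) -> (forall s, continuity_pt h s) ->
  (forall t, Rabs t <= M -> Rabs (g t - h t) <= B * cosh (lam * t)) ->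
  forall t, Rabs t <= M ->
    Rabs (double_primitive x0 x1 g t - double_primitive x0 x1 h t)
      <= B / lam ^ 2 * cosh (lam * t).
Proof.
  intros Hl HB Hg Hh H t Ht.
  apply (cosh_comparison
    (fun t => double_primitive x0 x1 g t - double_primitive x0 x1 h t)
    (fun t => (x1 + RInt g 0 t) - (x1 + RInt h 0 t)) (fun t => g t - h t) M); auto.
  - intros s _. apply (is_derive_minus (double_primitive x0 x1 g));
      now apply is_derive_double_primitive.
  - intros s _. apply (is_derive_minus (fun t => x1 + RInt g 0 t));
      now apply is_derive_primitive_plus.
  - rewrite !double_primitive_0. ring.
  - rewrite !RInt_0_0. ring.
Qed.

(** In the weight [cosh ((L + 1) t)] one step multiplies differences by [L / (L + 1)^2], which is at
    most 1/2. The weight is at least 1, so it costs nothing at the start, and at most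
    [cosh ((L + 1) M)] on the interval, which enters [C]. *)
Lemma picard_step M : exists C, 0 <= C /\ forall k t, Rabs t <= M ->
  Rabs (picard F x0 x1 (S k) t - picard F x0 x1 k t) <= C * (/ 2) ^ k.
Proof.
  destruct (F_lip M) as [L [HL HLip]].
  destruct (bounded_of_continuity (fun t => picard F x0 x1 1 t - picard F x0 x1 0 t) M)
    as [B [HB HBd]].
  { intros t. apply continuity_pt_minus; apply picard_continuity. }
  assert (Key : forall k t, Rabs t <= M ->
    Rabs (picard F x0 x1 (S k) t - picard F x0 x1 k t) <= B * (/ 2) ^ k * cosh ((L + 1) * t)).
  { induction k as [|k IH]; intros t Ht.
    - rewrite pow_O, Rmult_1_r. specialize (HBd t Ht).
      assert (G := cosh_ge_1 ((L + 1) * t)). nra.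
    - assert (P : 0 <= B * (/ 2) ^ k) by (apply Rmult_le_pos; auto; apply pow_le; lra).
      eapply Rle_trans.
      + apply (double_primitive_difference (rhs (S (S k))) (rhs (S k)) M (L + 1)
                 (L * (B * (/ 2) ^ k))); try apply rhs_continuity; auto; [lra|nra|].
        intros s Hs. eapply Rle_trans; [apply HLip; auto|].
        rewrite Rmult_assoc. apply Rmult_le_compat_l; auto.
      + apply Rmult_le_compat_r; [assert (G := cosh_ge_1 ((L + 1) * t)); lra|].
        apply Rle_div_l; [nra|]. simpl pow.
        replace (B * (/ 2 * (/ 2) ^ k)) with (B * (/ 2) ^ k * / 2) by ring.
        revert P. clear. generalize (B * (/ 2) ^ k). intros X HX.
        assert (0 <= X * (L ^ 2 + 1)) by (apply Rmult_le_pos; nra). lra. }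
  exists (B * cosh ((L + 1) * M)). split.
  { apply Rmult_le_pos; auto. assert (G := cosh_ge_1 ((L + 1) * M)). lra. }
  intros k t Ht. eapply Rle_trans; [now apply Key|].
  replace (B * cosh ((L + 1) * M) * (/ 2) ^ k) with (B * (/ 2) ^ k * cosh ((L + 1) * M)) by ring.
  apply Rmult_le_compat_l; [apply Rmult_le_pos; auto; apply pow_le; lra|].
  assert (Mono : forall a b, 0 <= a <= b -> cosh a <= cosh b).
  { intros a b Hab. destruct (is_derive_MVT cosh sinh a b) as [c [Hc E]].
    - intros; apply is_derive_Reals, derivable_pt_lim_cosh.
    - rewrite Rmin_left, Rmax_right in Hc by lra.
      assert (0 <= sinh c).
      { destruct (Rle_lt_or_eq_dec 0 c) as [l|l]; [lra| |].
        - rewrite <- sinh_0. left. now apply sinh_lt.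
        - rewrite <- l, sinh_0. lra. }
      nra. }
  assert (Ev : cosh ((L + 1) * t) = cosh ((L + 1) * Rabs t)).
  { unfold Rabs. destruct (Rcase_abs t); auto. unfold cosh.
    rewrite <- Ropp_mult_distr_r, Ropp_involutive. lra. }
  rewrite Ev. apply Mono. assert (Q := Rabs_pos t). split; [nra|].
  apply Rmult_le_compat_l; lra.
Qed.

Lemma picard_limit M : exists C, 0 <= C /\ forall k t, Rabs t <= M ->
  Rabs (ode_sol F x0 x1 t - picard F x0 x1 k t) <= C * (/ 2) ^ k.
Proof.
  destruct (picard_step M) as [C [HC H]]. exists (2 * C). split; [lra|].
  intros k t Ht.
  apply (geometric_cauchy_limit (fun k => picard F x0 x1 k t) C HC).
  intros j. now apply H.
Qed.

Lemma ode_sol_continuity t : continuity_pt (ode_sol F x0 x1) t.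
Proof.
  assert (Hr : 0 < Rabs t + 1) by (assert (Q := Rabs_pos t); lra).
  apply (CVU_continuity (fun k => picard F x0 x1 k) (ode_sol F x0 x1) 0 (mkposreal _ Hr)).
  - intros eps Heps. destruct (picard_limit (Rabs t + 1)) as [C [HC H]].
    destruct (geometric_eventually_small C eps HC Heps) as [N HN].
    exists N. intros k y Hk Hy. unfold Boule in Hy. simpl in Hy. rewrite Rminus_0_r in Hy.
    eapply Rle_lt_trans; [apply H; lra|auto].
  - intros; apply picard_continuity.
  - unfold Boule; simpl. rewrite Rminus_0_r. lra.
Qed.

Lemma ode_sol_fixed_point t :
  ode_sol F x0 x1 t = double_primitive x0 x1 (fun s => F (ode_sol F x0 x1 s) s) t.
Proof.
  set (h := fun s => F (ode_sol F x0 x1 s) s).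
  destruct (picard_limit (Rabs t)) as [C [HC H]].
  destruct (F_lip (Rabs t)) as [L [HL HLip]].
  (* The weight [lam = 1] suffices: no contraction is used here, the decay [(/ 2) ^ k] being
     supplied by [picard_limit]. *)
  assert (K : forall k, Rabs (picard F x0 x1 (S k) t - double_primitive x0 x1 h t)
      <= L * C * cosh (1 * t) * (/ 2) ^ k).
  { intros k. assert (P : 0 <= C * (/ 2) ^ k) by (apply Rmult_le_pos; auto; apply pow_le; lra).
    replace (L * C * cosh (1 * t) * (/ 2) ^ k)
      with (L * (C * (/ 2) ^ k) / 1 ^ 2 * cosh (1 * t)) by field.
    apply (double_primitive_difference (rhs (S k)) h (Rabs t) 1); try lra.
    - nra.
    - apply rhs_continuity.
    - apply continuity_pt_along, ode_sol_continuity.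
    - intros s Hs. unfold rhs, h. eapply Rle_trans; [apply HLip; auto|].
      rewrite Rabs_minus_sym. specialize (H k s Hs).
      apply Rle_trans with (L * (C * (/ 2) ^ k)); [now apply Rmult_le_compat_l|].
      assert (G := cosh_ge_1 (1 * s)). assert (0 <= L * (C * (/ 2) ^ k)) by nra. nra. }
  assert (HD : 0 <= L * C * cosh (1 * t) + C).
  { assert (G := cosh_ge_1 (1 * t)). assert (0 <= L * C) by nra. nra. }
  apply cond_eq. intros eps Heps.
  destruct (geometric_eventually_small _ eps HD Heps) as [N HN].
  specialize (HN N (Nat.le_refl N)). specialize (K N). specialize (H (S N) t (Rle_refl _)).
  replace (ode_sol F x0 x1 t - double_primitive x0 x1 h t) with
    ((ode_sol F x0 x1 t - picard F x0 x1 (S N) t)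
     + (picard F x0 x1 (S N) t - double_primitive x0 x1 h t)) by ring.
  eapply Rle_lt_trans; [apply Rabs_triang|].
  assert (C * (/ 2) ^ S N <= C * (/ 2) ^ N).
  { apply Rmult_le_compat_l; auto. simpl. assert (Q : 0 < (/ 2) ^ N) by (apply pow_lt; lra). lra. }
  lra.
Qed.

Lemma is_derive_ode_sol t : is_derive (ode_sol F x0 x1) t (ode_dsol F x0 x1 t).
Proof.
  apply is_derive_ext with (double_primitive x0 x1 (fun s => F (ode_sol F x0 x1 s) s)).
  - intros s. symmetry. apply ode_sol_fixed_point.
  - apply is_derive_double_primitive, continuity_pt_along, ode_sol_continuity.
Qed.

Lemma is_derive_ode_dsol t :
  is_derive (ode_dsol F x0 x1) t (F (ode_sol F x0 x1 t) t).
Proof.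
  apply (is_derive_primitive_plus x1 (fun s => F (ode_sol F x0 x1 s) s)).
  apply continuity_pt_along, ode_sol_continuity.
Qed.

Lemma ode_sol_0 : ode_sol F x0 x1 0 = x0.
Proof. rewrite ode_sol_fixed_point. apply double_primitive_0. Qed.

Lemma ode_dsol_0 : ode_dsol F x0 x1 0 = x1.
Proof. unfold ode_dsol. rewrite RInt_0_0. ring. Qed.

End Picard.

(** * Dependence on the initial condition *)

(** Gronwall for the difference, with [eps = 0]. The equations are assumed only between [t0] and [t]
    because the explicit exponentials to be compared solve them only for [t <= 0]. *)
Lemma ode_unique F (x x1 y y1 : R -> R) t0 t : locally_lipschitz_fst F ->
  (forall s, Rmin t0 t <= s <= Rmax t0 t -> is_derive x s (x1 s)) ->
  (forall s, Rmin t0 t <= s <= Rmax t0 t -> is_derive x1 s (F (x s) s)) ->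
  (forall s, Rmin t0 t <= s <= Rmax t0 t -> is_derive y s (y1 s)) ->
  (forall s, Rmin t0 t <= s <= Rmax t0 t -> is_derive y1 s (F (y s) s)) ->
  x t0 = y t0 -> x1 t0 = y1 t0 -> x t = y t.
Proof.
  intros HF Hx Hx1 Hy Hy1 E E1.
  destruct (HF (Rabs t0 + Rabs (t - t0))) as [L [HL Lip]].
  destruct (gronwall_segment (fun s => x s - y s) (fun s => x1 s - y1 s)
    (fun s => F (x s) s - F (y s) s) t0 t (Rabs (t - t0)) L 0 HL (Rle_refl 0)) as [H _];
    try lra.
  - intros s Hs. apply (is_derive_minus x y); auto.
  - intros s Hs. apply (is_derive_minus x1 y1); auto.
  - intros s Hs. rewrite Rplus_0_r. apply Lip. apply between_Rabs in Hs.
    replace s with (t0 + (s - t0)) by ring.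
    eapply Rle_trans; [apply Rabs_triang|]. lra.
  - rewrite E, E1, !Rminus_diag, Rabs_R0, !Rplus_0_r, Rmult_0_l in H.
    assert (P := Rabs_pos (x t - y t)).
    assert (Z : Rabs (x t - y t) = 0) by lra. apply Rabs_eq_0 in Z. lra.
Qed.

Lemma continuity_2d_pt_snd F a c : continuity_2d_pt F a c -> continuity_pt (F a) c.
Proof.
  intros H eps Heps. destruct (H (mkposreal eps Heps)) as [d Hd].
  exists d. split; [apply cond_pos|]. intros y [_ Hy]. apply Hd; [|exact Hy].
  rewrite Rminus_diag, Rabs_R0. apply cond_pos.
Qed.

Lemma continuity_2d_pt_tube (Q : R -> R -> R) a M eps :
  (forall x t, continuity_2d_pt Q x t) -> 0 < eps ->
  exists d, 0 < d /\ forall x t, Rabs (x - a) < d -> Rabs t <= M -> Rabs (Q x t - Q a t) < eps.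
Proof.
  intros HQ He.
  destruct (uniform_continuity_2d_1d' Q (- M) M a (fun t _ => HQ a t) (mkposreal eps He))
    as [d Hd].
  exists d. split; [apply cond_pos|]. intros x t Hx Ht.
  apply Rabs_le_between in Ht. apply Rabs_def2 in Hx. assert (P := cond_pos d).
  apply (Hd t a t x); auto; try lra. rewrite Rminus_diag, Rabs_R0. apply cond_pos.
Qed.

Lemma uniform_difference_quotient (Q Qa : R -> R -> R) a M eps :
  (forall x t, is_derive (fun s => Q s t) x (Qa x t)) ->
  (forall x t, continuity_2d_pt Qa x t) -> 0 < eps ->
  exists d, 0 < d /\ forall h t, Rabs h < d -> Rabs t <= M ->
    Rabs (Q (a + h) t - Q a t - h * Qa a t) <= eps * Rabs h.
Proof.
  intros HQ HC He. destruct (continuity_2d_pt_tube Qa a M eps HC He) as [d [Hd H]].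
  exists d. split; auto. intros h t Hh Ht.
  destruct (is_derive_MVT (fun s => Q s t) (fun s => Qa s t) a (a + h)) as [c [Hc E]]; auto.
  apply between_Rabs in Hc. simpl in E. replace (a + h - a) with h in * by ring.
  rewrite E. replace (Qa c t * h - h * Qa a t) with ((Qa c t - Qa a t) * h) by ring.
  rewrite Rabs_mult. apply Rmult_le_compat_r; [apply Rabs_pos|].
  left. apply H; auto. lra.
Qed.

(** Continuity of the map from the parameter to the solution, for uniform convergence on compact
    time intervals: the form in which Gronwall delivers it. *)
Definition family_cont_at (w : R -> R -> R) (a : R) : Prop :=
  forall M eps, 0 < eps -> exists d, 0 < d /\
    forall x t, Rabs (x - a) < d -> Rabs t <= M -> Rabs (w x t - w a t) <= eps.

Lemma continuity_2d_pt_of_family w a t :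
  family_cont_at w a -> continuity_pt (w a) t -> continuity_2d_pt w a t.
Proof.
  intros H Hc eps. assert (He := cond_pos eps).
  destruct (H (Rabs t + 1) (eps / 2)) as [d [Pd Hd]]; [lra|].
  destruct (Hc (eps / 2)) as [d' [Pd' Hd']]; [lra|].
  assert (Hm : 0 < Rmin 1 (Rmin d d')) by (repeat apply Rmin_pos; lra).
  exists (mkposreal _ Hm). simpl. intros x s Hx Hs.
  assert (M1 := Rmin_l 1 (Rmin d d')). assert (M2 := Rmin_r 1 (Rmin d d')).
  assert (M3 := Rmin_l d d'). assert (M4 := Rmin_r d d').
  assert (A : Rabs (w x s - w a s) <= eps / 2).
  { apply Hd; [lra|]. replace s with (t + (s - t)) by ring.
    eapply Rle_trans; [apply Rabs_triang|]. lra. }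
  assert (B : Rabs (w a s - w a t) < eps / 2).
  { destruct (Req_dec s t) as [->|N].
    - rewrite Rminus_diag, Rabs_R0. lra.
    - apply Hd'. split; [split; auto; exact I|]. simpl. unfold R_dist. lra. }
  replace (w x s - w a t) with ((w x s - w a s) + (w a s - w a t)) by ring.
  eapply Rle_lt_trans; [apply Rabs_triang|]. lra.
Qed.

(** Gronwall for [w x - w a]. The order of quantifiers matters: [L] is fixed before [eps], so the
    growth factor is known when [eps] is chosen. *)
Lemma family_cont_of_ode (w z G : R -> R -> R) a :
  (forall x t, is_derive (w x) t (z x t)) -> (forall x t, is_derive (z x) t (G x t)) ->
  (forall M, exists L, 0 <= L /\ forall eps, 0 < eps -> exists d, 0 < d /\
     forall x, Rabs (x - a) < d ->
       Rabs (w x 0 - w a 0) <= eps /\ Rabs (z x 0 - z a 0) <= eps /\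
       forall t, Rabs t <= M -> Rabs (G x t - G a t) <= L * Rabs (w x t - w a t) + eps) ->
  family_cont_at w a /\ family_cont_at z a.
Proof.
  intros Hw Hz H.
  assert (K : forall M eps, 0 < eps -> exists d, 0 < d /\
    forall x t, Rabs (x - a) < d -> Rabs t <= M ->
      Rabs (w x t - w a t) <= eps /\ Rabs (z x t - z a t) <= eps).
  { intros M eps He. destruct (H M) as [L [HL HLip]].
    set (C := exp ((2 + L) * M)). assert (HC : 0 < C) by apply exp_pos.
    (* A third each for the two initial differences and the source, all amplified by [C]. *)
    destruct (HLip (eps / (3 * C))) as [d [Hd Hb]]; [apply Rdiv_lt_0_compat; lra|].
    exists d. split; auto. intros x t Hx Ht.
    destruct (Hb x Hx) as (I1 & I2 & I3).
    assert (Hq : 0 <= eps / (3 * C)) by (left; apply Rdiv_lt_0_compat; lra).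
    assert (Q : (Rabs (w x 0 - w a 0) + Rabs (z x 0 - z a 0) + eps / (3 * C)) * C <= eps).
    { replace eps with (eps / (3 * C) * 3 * C) at 2 by (field; lra).
      apply Rmult_le_compat_r; lra. }
    destruct (gronwall_second_order (fun s => w x s - w a s) (fun s => z x s - z a s)
      (fun s => G x s - G a s) 0 M L (eps / (3 * C)) HL Hq) with t as [A B].
    - intros s _. now apply (is_derive_minus (w x) (w a)).
    - intros s _. now apply (is_derive_minus (z x) (z a)).
    - intros s Hs. rewrite Rminus_0_r in Hs. auto.
    - now rewrite Rminus_0_r.
    - fold C in A, B. lra. }
  split; intros M eps He; destruct (K M eps He) as [d [Hd Hb]]; exists d; split; auto;
    intros x t Hx Ht; now apply Hb.
Qed.

Lemma is_derive_of_small_o (f : R -> R) a l :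
  (forall eps, 0 < eps -> exists d, 0 < d /\
     forall h, Rabs h < d -> Rabs (f (a + h) - f a - h * l) <= eps * Rabs h) ->
  is_derive f a l.
Proof.
  intros H. apply is_derive_Reals. intros eps He.
  destruct (H (eps / 2)) as [d [Hd Hb]]; [lra|].
  exists (mkposreal d Hd). intros h Hh0 Hh. simpl in Hh.
  replace ((f (a + h) - f a) / h - l) with ((f (a + h) - f a - h * l) * / h) by (field; auto).
  rewrite Rabs_mult, Rabs_inv.
  assert (P : 0 < Rabs h) by now apply Rabs_pos_lt.
  apply Rle_lt_trans with (eps / 2 * Rabs h * / Rabs h).
  - apply Rmult_le_compat_r; auto. left. now apply Rinv_0_lt_compat.
  - replace (eps / 2 * Rabs h * / Rabs h) with (eps / 2) by (field; lra). lra.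
Qed.

(** The remainder [w (a + h) - w a - h y] starts from zero data and satisfies a Gronwall inequality
    with source [eps * |h|], hence is [o (h)]. The candidate [y] is supplied from outside. *)
Lemma family_derive_of_ode (w z G : R -> R -> R) (y y1 H : R -> R) a :
  (forall x t, is_derive (w x) t (z x t)) -> (forall x t, is_derive (z x) t (G x t)) ->
  (forall t, is_derive y t (y1 t)) -> (forall t, is_derive y1 t (H t)) ->
  (forall h, w (a + h) 0 - w a 0 - h * y 0 = 0) ->
  (forall h, z (a + h) 0 - z a 0 - h * y1 0 = 0) ->
  (forall M, exists L, 0 <= L /\ forall eps, 0 < eps -> exists d, 0 < d /\
     forall h t, Rabs h < d -> Rabs t <= M ->
       Rabs (G (a + h) t - G a t - h * H t)
         <= L * Rabs (w (a + h) t - w a t - h * y t) + eps * Rabs h) ->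
  forall t, is_derive (fun x => w x t) a (y t) /\ is_derive (fun x => z x t) a (y1 t).
Proof.
  intros Hw Hz Hy Hy1 I0 I1 HH t. destruct (HH (Rabs t)) as [L [HL HLip]].
  set (C := exp ((2 + L) * Rabs t)). assert (HC : 0 < C) by apply exp_pos.
  assert (K : forall eps, 0 < eps -> exists d, 0 < d /\ forall h, Rabs h < d ->
      Rabs (w (a + h) t - w a t - h * y t) <= eps * Rabs h /\
      Rabs (z (a + h) t - z a t - h * y1 t) <= eps * Rabs h).
  { intros eps He. destruct (HLip (eps / C)) as [d [Hd Hb]]; [now apply Rdiv_lt_0_compat|].
    exists d. split; auto. intros h Hh.
    assert (Hq : 0 <= eps / C * Rabs h)
      by (apply Rmult_le_pos; [left; now apply Rdiv_lt_0_compat|apply Rabs_pos]).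
    destruct (gronwall_second_order (fun s => w (a + h) s - w a s - h * y s)
      (fun s => z (a + h) s - z a s - h * y1 s)
      (fun s => G (a + h) s - G a s - h * H s) 0 (Rabs t) L (eps / C * Rabs h) HL Hq)
      with t as [A B].
    - intros s _. apply (is_derive_minus (fun s => w (a + h) s - w a s)).
      + now apply (is_derive_minus (w (a + h)) (w a)).
      + now apply (is_derive_scal y).
    - intros s _. apply (is_derive_minus (fun s => z (a + h) s - z a s)).
      + now apply (is_derive_minus (z (a + h)) (z a)).
      + now apply (is_derive_scal y1).
    - intros s Hs. rewrite Rminus_0_r in Hs. auto.
    - rewrite Rminus_0_r. lra.
    - rewrite I0, I1, Rabs_R0, !Rplus_0_l in A, B. fold C in A, B.
      replace (eps / C * Rabs h * C) with (eps * Rabs h) in A, B by (field; lra).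
      now split. }
  split; apply is_derive_of_small_o; intros eps He; destruct (K eps He) as [d [Hd Hb]];
    exists d; split; auto; intros h Hh; now apply Hb.
Qed.

(** * Linear equations with coefficients depending on a parameter *)

Definition linear_family (q g w z : R -> R -> R) : Prop :=
  (forall x t, is_derive (w x) t (z x t)) /\
  (forall x t, is_derive (z x) t (q x t * w x t + g x t)).

Section Linear.
Variables (q g w z : R -> R -> R) (a0 b0 : R).
Hypothesis q_cont : forall x t, continuity_2d_pt q x t.
Hypothesis g_cont : forall x t, continuity_2d_pt g x t.
Hypothesis wz_sol : linear_family q g w z.
Hypothesis w_init : forall x, w x 0 = a0.
Hypothesis z_init : forall x, z x 0 = b0.

Lemma linear_family_bounded x M :
  exists B, 0 <= B /\ forall t, Rabs t <= M -> Rabs (q x t) <= B /\ Rabs (w x t) <= B.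
Proof.
  destruct wz_sol as [Hw Hz].
  destruct (bounded_of_continuity (q x) M) as [B [HB H]];
    [intros; now apply continuity_2d_pt_snd|].
  destruct (bounded_of_continuity (w x) M) as [B' [HB' H']];
    [intros; eapply continuity_pt_of_is_derive, Hw|].
  exists (B + B'). split; [lra|]. intros t Ht. specialize (H t Ht). specialize (H' t Ht). lra.
Qed.

Lemma linear_family_cont a : family_cont_at w a /\ family_cont_at z a.
Proof.
  destruct wz_sol as [Hw Hz].
  apply (family_cont_of_ode w z (fun x t => q x t * w x t + g x t)); auto.
  intros M. destruct (linear_family_bounded a M) as [B [HB Hb]].
  exists (B + 1). split; [lra|]. intros eps He.
  (* The [1] keeps [|q x t|] below [B + 1] for [x] near [a]; the other bound makes
     [(q x t - q a t) * w a t] at most [eps / 2], leaving the other half to [g]. *)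
  assert (P : 0 < Rmin 1 (eps / (2 * (B + 1))))
    by (apply Rmin_pos; [lra|apply Rdiv_lt_0_compat; lra]).
  destruct (continuity_2d_pt_tube q a M _ q_cont P) as [d1 [Hd1 T1]].
  destruct (continuity_2d_pt_tube g a M (eps / 2) g_cont) as [d2 [Hd2 T2]]; [lra|].
  exists (Rmin d1 d2). split; [now apply Rmin_pos|]. intros x Hx.
  rewrite !w_init, !z_init, !Rminus_diag, Rabs_R0. split; [lra|]. split; [lra|].
  intros t Ht. assert (M1 := Rmin_l d1 d2). assert (M2 := Rmin_r d1 d2).
  assert (X1 : Rabs (q x t - q a t) < Rmin 1 (eps / (2 * (B + 1)))) by (apply T1; lra).
  assert (X2 : Rabs (g x t - g a t) < eps / 2) by (apply T2; lra).
  destruct (Hb t Ht) as [Bq Bw].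
  assert (Y1 := Rmin_l 1 (eps / (2 * (B + 1)))). assert (Y2 := Rmin_r 1 (eps / (2 * (B + 1)))).
  replace (q x t * w x t + g x t - (q a t * w a t + g a t)) with
    (((q a t + (q x t - q a t)) * (w x t - w a t) + (q x t - q a t) * w a t)
     + (g x t - g a t)) by ring.
  eapply Rle_trans; [apply Rabs_triang|].
  assert (Z1 : Rabs ((q a t + (q x t - q a t)) * (w x t - w a t))
                <= (B + 1) * Rabs (w x t - w a t)).
  { rewrite Rabs_mult. apply Rmult_le_compat_r; [apply Rabs_pos|].
    eapply Rle_trans; [apply Rabs_triang|]. lra. }
  assert (Z2 : Rabs ((q x t - q a t) * w a t) <= eps / 2).
  { rewrite Rabs_mult. apply Rle_trans with (eps / (2 * (B + 1)) * (B + 1)).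
    - apply Rmult_le_compat; try apply Rabs_pos; lra.
    - right. field. lra. }
  assert (Z3 := Rabs_triang ((q a t + (q x t - q a t)) * (w x t - w a t))
                  ((q x t - q a t) * w a t)).
  lra.
Qed.

Lemma linear_family_continuity_2d x t : continuity_2d_pt w x t /\ continuity_2d_pt z x t.
Proof.
  destruct wz_sol as [Hw Hz].
  split; (apply continuity_2d_pt_of_family; [apply linear_family_cont|
    eapply continuity_pt_of_is_derive; auto]).
Qed.

(** Differentiating [z' = q w + g] formally in the parameter gives the same equation with source
    [qa w + ga]; the data of [y] vanish because those of [w] do not depend on the parameter. *)
Lemma linear_family_derive (qa ga y y1 : R -> R -> R) :
  (forall x t, is_derive (fun s => q s t) x (qa x t)) ->
  (forall x t, is_derive (fun s => g s t) x (ga x t)) ->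
  (forall x t, continuity_2d_pt qa x t) -> (forall x t, continuity_2d_pt ga x t) ->
  linear_family q (fun x t => qa x t * w x t + ga x t) y y1 ->
  (forall x, y x 0 = 0) -> (forall x, y1 x 0 = 0) ->
  forall x t, is_derive (fun s => w s t) x (y x t) /\ is_derive (fun s => z s t) x (y1 x t).
Proof.
  intros Hqa Hga Cqa Cga [Hy Hy1] Iy Iy1 a. destruct wz_sol as [Hw Hz].
  apply (family_derive_of_ode w z (fun x t => q x t * w x t + g x t) (y a) (y1 a)
    (fun t => q a t * y a t + (qa a t * w a t + ga a t))); auto.
  { intros h. rewrite !w_init, Iy. ring. }
  { intros h. rewrite !z_init, Iy1. ring. }
  intros M. destruct (linear_family_bounded a M) as [B [HB Hb]].
  destruct (bounded_of_continuity (qa a) M) as [B' [HB' Hb']];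
    [intros; now apply continuity_2d_pt_snd|].
  exists B. split; auto. intros eps He.
  (* In units of [eta * |h|] the error terms are [B] from the remainder of [q] against [w], [B']
     from [qa] against the variation of [w], 1 from the remainder of [g], and 1 from the product of
     two small factors, where [eta <= 1] is used. *)
  set (eta := Rmin 1 (eps / (B + B' + 2))).
  assert (P : 0 < eta) by (apply Rmin_pos; [lra|apply Rdiv_lt_0_compat; lra]).
  assert (E1 : eta <= 1) by apply Rmin_l.
  assert (E2 : eta * (B + B' + 2) <= eps).
  { apply Rle_trans with (eps / (B + B' + 2) * (B + B' + 2)).
    - apply Rmult_le_compat_r; [lra|apply Rmin_r].
    - right. field. lra. }
  destruct (uniform_difference_quotient q qa a M eta Hqa Cqa P) as [d1 [Hd1 T1]].
  destruct (uniform_difference_quotient g ga a M eta Hga Cga P) as [d2 [Hd2 T2]].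
  destruct (linear_family_cont a) as [Cw _]. destruct (Cw M eta P) as [d3 [Hd3 T3]].
  exists (Rmin d1 (Rmin d2 d3)). split; [repeat apply Rmin_pos; auto|].
  intros h t Hh Ht.
  assert (M1 := Rmin_l d1 (Rmin d2 d3)). assert (M2 := Rmin_r d1 (Rmin d2 d3)).
  assert (M3 := Rmin_l d2 d3). assert (M4 := Rmin_r d2 d3).
  assert (X1 : Rabs (q (a + h) t - q a t - h * qa a t) <= eta * Rabs h) by (apply T1; lra).
  assert (X2 : Rabs (g (a + h) t - g a t - h * ga a t) <= eta * Rabs h) by (apply T2; lra).
  assert (X3 : Rabs (w (a + h) t - w a t) <= eta).
  { apply T3; auto. replace (a + h - a) with h by ring. lra. }
  destruct (Hb t Ht) as [Bq Bw]. specialize (Hb' t Ht).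
  assert (Ph := Rabs_pos h).
  replace (q (a + h) t * w (a + h) t + g (a + h) t - (q a t * w a t + g a t)
           - h * (q a t * y a t + (qa a t * w a t + ga a t))) with
    (q a t * (w (a + h) t - w a t - h * y a t)
     + (((q (a + h) t - q a t - h * qa a t) + h * qa a t) * (w (a + h) t - w a t)
        + ((q (a + h) t - q a t - h * qa a t) * w a t
           + (g (a + h) t - g a t - h * ga a t)))) by ring.
  set (e := w (a + h) t - w a t - h * y a t) in *.
  set (rq := q (a + h) t - q a t - h * qa a t) in *.
  set (rg := g (a + h) t - g a t - h * ga a t) in *.
  set (dw := w (a + h) t - w a t) in *.
  eapply Rle_trans; [apply Rabs_triang|]. apply Rplus_le_compat.
  { rewrite Rabs_mult. apply Rmult_le_compat_r; [apply Rabs_pos|lra]. }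
  eapply Rle_trans; [apply Rabs_triang|].
  assert (Z1 : Rabs ((rq + h * qa a t) * dw) <= (eta * Rabs h + Rabs h * B') * eta).
  { rewrite Rabs_mult. apply Rmult_le_compat; try apply Rabs_pos; auto.
    eapply Rle_trans; [apply Rabs_triang|]. rewrite Rabs_mult.
    apply Rplus_le_compat; auto. now apply Rmult_le_compat_l. }
  assert (Z2 : Rabs (rq * w a t) <= eta * Rabs h * B).
  { rewrite Rabs_mult. apply Rmult_le_compat; try apply Rabs_pos; auto. }
  assert (Z3 := Rabs_triang (rq * w a t) rg).
  assert (Z4 : eta * Rabs h * eta <= eta * Rabs h * 1) by (apply Rmult_le_compat_l; nra).
  assert (Z5 : eta * (B + B' + 2) * Rabs h <= eps * Rabs h) by now apply Rmult_le_compat_r.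
  lra.
Qed.

End Linear.

Lemma linear_rhs_continuity (q g : R -> R -> R) a x t :
  (forall x t, continuity_2d_pt q x t) -> (forall x t, continuity_2d_pt g x t) ->
  continuity_2d_pt (fun x t => q a t * x + g a t) x t.
Proof.
  intros Hq Hg.
  apply (continuity_2d_pt_plus (fun x t => q a t * x) (fun _ t => g a t)).
  - apply continuity_2d_pt_mult; [|apply continuity_2d_pt_id1].
    apply (continuity_2d_pt_comp q (fun _ _ => a) (fun _ t => t)); auto;
      [apply continuity_2d_pt_const|apply continuity_2d_pt_id2].
  - apply (continuity_2d_pt_comp g (fun _ _ => a) (fun _ t => t)); auto;
      [apply continuity_2d_pt_const|apply continuity_2d_pt_id2].
Qed.

Lemma linear_rhs_lipschitz (q g : R -> R -> R) a :
  (forall x t, continuity_2d_pt q x t) ->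
  locally_lipschitz_fst (fun x t => q a t * x + g a t).
Proof.
  intros Hq M. destruct (bounded_of_continuity (q a) M) as [B [HB Hb]];
    [intros; now apply continuity_2d_pt_snd|].
  exists B. split; auto. intros x y t Ht.
  replace (q a t * x + g a t - (q a t * y + g a t)) with (q a t * (x - y)) by ring.
  rewrite Rabs_mult. apply Rmult_le_compat_r; [apply Rabs_pos|auto].
Qed.

Lemma linear_family_exists (q g : R -> R -> R) a0 b0 :
  (forall x t, continuity_2d_pt q x t) -> (forall x t, continuity_2d_pt g x t) ->
  exists w z, linear_family q g w z /\ (forall x, w x 0 = a0) /\ (forall x, z x 0 = b0).
Proof.
  intros Hq Hg.
  exists (fun a => ode_sol (fun x t => q a t * x + g a t) a0 b0),
         (fun a => ode_dsol (fun x t => q a t * x + g a t) a0 b0).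
  assert (C := fun a x t => linear_rhs_continuity q g a x t Hq Hg).
  assert (L := fun a => linear_rhs_lipschitz q g a Hq).
  split; [split|split]; intros a.
  - intros t. now apply is_derive_ode_sol.
  - intros t. apply (is_derive_ode_dsol (fun x t => q a t * x + g a t)); auto.
  - apply ode_sol_0; auto.
  - apply ode_dsol_0.
Qed.

(* The parameter derivative of a solution solves the same linear equation with
   another source term, hence the induction on [k]. *)
Lemma Ck_linear_family k : forall (q g w z : R -> R -> R) a0 b0,
  Ck everywhere k q -> Ck everywhere k g -> linear_family q g w z ->
  (forall x, w x 0 = a0) -> (forall x, z x 0 = b0) ->
  Ck everywhere k w /\ Ck everywhere k z.
Proof.
  induction k as [|k IH]; intros q g w z a0 b0 Hq Hg Hs Iw Iz;
    assert (Cq := fun x t => Ck_continuous _ _ _ x t Hq I);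
    assert (Cg := fun x t => Ck_continuous _ _ _ x t Hg I);
    assert (Cwz := fun x t => linear_family_continuity_2d q g w z a0 b0 Cq Cg Hs Iw Iz x t).
  - split; split; auto; intros; now apply Cwz.
  - assert (Pq := Ck_pred _ _ _ Hq). assert (Pg := Ck_pred _ _ _ Hg).
    (* The induction hypothesis serves twice at order [k]: here for [w], which makes the source
       [qa w + ga] of class C^k, and below for the solution [y] with that source. *)
    destruct (IH q g w z a0 b0 Pq Pg Hs Iw Iz) as [Pw Pz].
    destruct Hq as [_ (qa & qc & q1 & _ & q3 & _)].
    destruct Hg as [_ (ga & gc & g1 & _ & g3 & _)].
    assert (G : Ck everywhere k (fun x t => qa x t * w x t + ga x t))
      by (apply Ck_plus; auto; now apply Ck_mult).
    destruct (linear_family_exists q (fun x t => qa x t * w x t + ga x t) 0 0)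
      as (y & y1 & Hy & Iy & Iy1); auto.
    { intros; apply (Ck_continuous _ _ _ x t G I). }
    destruct (IH q _ y y1 0 0 Pq G Hy Iy Iy1) as [Py Py1].
    assert (Dv := linear_family_derive q g w z a0 b0 Cq Cg Hs Iw Iz qa ga y y1
      (fun x t => q1 x t I) (fun x t => g1 x t I)
      (fun x t => Ck_continuous _ _ _ x t q3 I) (fun x t => Ck_continuous _ _ _ x t g3 I)
      Hy Iy Iy1).
    destruct Hs as [Hw Hz]. split.
    + split; [intros; apply Cwz|]. exists y, z.
      split; [|split; [|split]]; auto. intros; apply Dv.
    + split; [intros; apply Cwz|]. exists y1, (fun x t => q x t * w x t + g x t).
      split; [|split; [|split]]; auto; [intros; apply Dv|].
      apply Ck_plus; auto. now apply Ck_mult.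
Qed.

(** * Smoothness of the nonlinear flow in its initial value *)

Section Nonlinear.
Variables (f fv v z w w1 : R -> R -> R) (p : R).
Hypothesis f_smooth : forall k, Ck everywhere k f.
Hypothesis fv_smooth : forall k, Ck everywhere k fv.
Hypothesis f_deriv : forall x t, is_derive (fun s => f s t) x (fv x t).
Hypothesis f_lip : locally_lipschitz_fst f.
Hypothesis v_deriv : forall a t, is_derive (v a) t (z a t).
Hypothesis z_deriv : forall a t, is_derive (z a) t (f (v a t) t).
Hypothesis v_init : forall a, v a 0 = a.
Hypothesis z_init : forall a, z a 0 = p * a.

Lemma flow_lipschitz a M : exists C, 0 <= C /\
  forall x t, Rabs t <= M ->
    Rabs (v x t - v a t) <= C * Rabs (x - a) /\ Rabs (z x t - z a t) <= C * Rabs (x - a).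
Proof.
  destruct (f_lip M) as [L [HL Lip]].
  exists ((1 + Rabs p) * exp ((2 + L) * M)). split.
  { apply Rmult_le_pos; [|left; apply exp_pos]. assert (P := Rabs_pos p). lra. }
  intros x t Ht.
  assert (E : (1 + Rabs p) * exp ((2 + L) * M) * Rabs (x - a)
    = (Rabs (v x 0 - v a 0) + Rabs (z x 0 - z a 0) + 0) * exp ((2 + L) * M)).
  { rewrite !v_init, !z_init. replace (p * x - p * a) with (p * (x - a)) by ring.
    rewrite Rabs_mult. ring. }
  rewrite E.
  apply (gronwall_second_order (fun s => v x s - v a s) (fun s => z x s - z a s)
      (fun s => f (v x s) s - f (v a s) s)); auto; try lra.
  - intros s _. now apply (is_derive_minus (v x) (v a)).
  - intros s _. now apply (is_derive_minus (z x) (z a)).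
  - intros s Hs. rewrite Rminus_0_r in Hs. rewrite Rplus_0_r. now apply Lip.
  - now rewrite Rminus_0_r.
Qed.

Lemma flow_continuity_2d a t : continuity_2d_pt v a t /\ continuity_2d_pt z a t.
Proof.
  assert (K : family_cont_at v a /\ family_cont_at z a).
  { split; intros M eps He; destruct (flow_lipschitz a M) as [C [HC H]];
    (exists (eps / (C + 1)); split; [apply Rdiv_lt_0_compat; lra|]);
    intros x s Hx Hs; destruct (H x s Hs) as [A B];
    (apply Rle_trans with (C * (eps / (C + 1)));
      [eapply Rle_trans; [eassumption|apply Rmult_le_compat_l; lra]|]);
    (apply Rle_trans with ((C + 1) * (eps / (C + 1)));
      [apply Rmult_le_compat_r; [left; apply Rdiv_lt_0_compat; lra|lra]|right; field; lra]). }
  destruct K. split; apply continuity_2d_pt_of_family; auto;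
    eapply continuity_pt_of_is_derive; auto.
Qed.

Hypothesis w_sol : linear_family (fun a t => fv (v a t) t) (fun _ _ => 0) w w1.
Hypothesis w_init : forall a, w a 0 = 1.
Hypothesis w1_init : forall a, w1 a 0 = p.

Lemma flow_derive a t :
  is_derive (fun s => v s t) a (w a t) /\ is_derive (fun s => z s t) a (w1 a t).
Proof.
  revert t. destruct w_sol as [Hw Hw1].
  assert (Cfv : forall x t, continuity_2d_pt fv x t)
    by (intros; apply (Ck_continuous _ _ _ x t (fv_smooth 0) I)).
  apply (family_derive_of_ode v z (fun a t => f (v a t) t) (w a) (w1 a)
    (fun t => fv (v a t) t * w a t + 0)); auto.
  { intros h. rewrite !v_init, w_init. ring. }
  { intros h. rewrite !z_init, w1_init. ring. }
  intros M. destruct (flow_lipschitz a M) as [C [HC HCb]].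
  destruct (bounded_of_continuity (v a) M) as [B [HB Hb]];
    [intros; eapply continuity_pt_of_is_derive; auto|].
  destruct (bounded_of_continuity (fun t => fv (v a t) t) M) as [L [HL HLb]].
  { apply (continuity_pt_along fv Cfv (v a)).
    intros; eapply continuity_pt_of_is_derive; auto. }
  exists L. split; auto. intros eps He.
  assert (P : 0 < eps / (C + 1)) by (apply Rdiv_lt_0_compat; lra).
  (* The margin 1 around [|v a t| <= B] makes room for the intermediate point [c] between [v a t]
     and [v (a + h) t]; [flow_lipschitz] keeps it within [Rmin 1 d] of [v a t]. *)
  destruct (uniform_continuity_2d fv (- (B + 1)) (B + 1) (- M) M
    (fun x y _ _ => Cfv x y) (mkposreal _ P)) as [d Hd]. simpl in Hd.
  assert (Pm : 0 < Rmin 1 d) by (apply Rmin_pos; [lra|apply cond_pos]).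
  exists (Rmin 1 d / (C + 1)). split; [apply Rdiv_lt_0_compat; lra|].
  intros h t Hh Ht.
  destruct (HCb (a + h) t Ht) as [Dv _]. replace (a + h - a) with h in Dv by ring.
  assert (Small : C * Rabs h < Rmin 1 d).
  { apply Rle_lt_trans with ((C + 1) * Rabs h); [assert (Q := Rabs_pos h); lra|].
    replace (Rmin 1 d) with ((C + 1) * (Rmin 1 d / (C + 1))) by (field; lra).
    apply Rmult_lt_compat_l; lra. }
  destruct (is_derive_MVT (fun s => f s t) (fun s => fv s t) (v a t) (v (a + h) t))
    as [c [Hc E]]; auto.
  apply between_Rabs in Hc. simpl in E.
  assert (M1 := Rmin_l 1 d). assert (M2 := Rmin_r 1 d). specialize (Hb t Ht).
  assert (Bv := Rabs_le_between (v a t) B). apply Bv in Hb. clear Bv.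
  assert (Bc : Rabs (c - v a t) < 1) by lra. apply Rabs_def2 in Bc.
  assert (T : Rabs (fv c t - fv (v a t) t) < eps / (C + 1)).
  { apply Rabs_le_between in Ht. apply Hd; try lra.
    rewrite Rminus_diag, Rabs_R0. apply cond_pos. }
  rewrite E.
  replace (fv c t * (v (a + h) t - v a t) - h * (fv (v a t) t * w a t + 0)) with
    (fv (v a t) t * (v (a + h) t - v a t - h * w a t)
     + (fv c t - fv (v a t) t) * (v (a + h) t - v a t)) by ring.
  eapply Rle_trans; [apply Rabs_triang|]. rewrite !Rabs_mult. apply Rplus_le_compat.
  - apply Rmult_le_compat_r; [apply Rabs_pos|auto].
  - apply Rle_trans with (eps / (C + 1) * ((C + 1) * Rabs h)).
    + apply Rmult_le_compat; try apply Rabs_pos; [lra|]. assert (Q := Rabs_pos h). lra.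
    + right. field. lra.
Qed.

Lemma flow_Ck k : Ck everywhere k v /\ Ck everywhere k z.
Proof.
  induction k as [|k [Pv Pz]].
  - split; split; auto; intros; apply flow_continuity_2d.
  - assert (Q : Ck everywhere k (fun a t => fv (v a t) t)).
    { apply (Ck_comp everywhere k fv v (fun _ t => t)); auto. apply Ck_snd. }
    destruct (Ck_linear_family k _ _ w w1 1 p Q (Ck_const _ _ 0) w_sol w_init w1_init)
      as [Pw Pw1].
    split; (split; [intros; apply flow_continuity_2d|]).
    + exists w, z. split; [|split; [|split]]; auto. intros; apply flow_derive.
    + exists w1, (fun a t => f (v a t) t). split; [|split; [|split]]; auto.
      * intros; apply flow_derive.
      * apply (Ck_comp everywhere k f v (fun _ t => t)); auto. apply Ck_snd.
Qed.

End Nonlinear.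

(** * Boundedness, positivity and surjectivity criteria *)

Lemma bounded_on_rectangle (F : R -> R -> R) a b :
  (forall x y, continuity_2d_pt F x y) -> 0 <= a ->
  exists B, 0 <= B /\ forall x y, Rabs x <= a -> Rabs y <= b -> Rabs (F x y) <= B.
Proof.
  intros HF Ha.
  destruct (bounded_of_continuity (F (- a)) b) as [B0 [HB0 Hb0]];
    [intros; now apply continuity_2d_pt_snd|].
  destruct (uniform_continuity_2d F (- a) a (- b) b (fun x y _ _ => HF x y)
    (mkposreal 1 Rlt_0_1)) as [d Hd]. simpl in Hd.
  assert (Pd := cond_pos d).
  (* The rectangle is crossed from its left edge in steps of length [d / 2], each changing [F] by
     less than 1. *)
  assert (K : forall k x y, - a <= x <= a -> x <= - a + INR k * (d / 2) -> Rabs y <= b ->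
                Rabs (F x y) <= B0 + INR k).
  { induction k as [|k IH]; intros x y Hx Hk Hy.
    - simpl in Hk. replace x with (- a) by lra. simpl. rewrite Rplus_0_r. auto.
    - rewrite S_INR in *. assert (Hy' := Hy). apply Rabs_le_between in Hy'.
      set (x' := Rmax (- a) (x - d / 2)).
      assert (X1 := Rmax_l (- a) (x - d / 2)). assert (X2 := Rmax_r (- a) (x - d / 2)).
      assert (X3 : x' <= x) by (apply Rmax_lub; lra).
      assert (X4 : x' <= - a + INR k * (d / 2)).
      { apply Rmax_lub; [|lra]. assert (0 <= INR k) by apply pos_INR. nra. }
      fold x' in X1, X2.
      assert (I1 : Rabs (F x' y) <= B0 + INR k) by (apply IH; auto; lra).
      assert (I2 : Rabs (F x y - F x' y) < 1).
      { apply Hd; try lra; [|rewrite Rminus_diag, Rabs_R0; lra].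
        rewrite Rabs_pos_eq; lra. }
      replace (F x y) with ((F x y - F x' y) + F x' y) by ring.
      eapply Rle_trans; [apply Rabs_triang|]. lra. }
  destruct (INR_unbounded (2 * a / (d / 2))) as [N HN].
  exists (B0 + INR N). split; [assert (0 <= INR N) by apply pos_INR; lra|].
  intros x y Hx Hy. apply Rabs_le_between in Hx. apply K; auto.
  apply Rgt_lt in HN. apply Rlt_div_l in HN; lra.
Qed.

Lemma Derive_vanishing_far (g : R -> R) K : (forall u, K < Rabs u -> g u = 0) ->
  forall u, K < Rabs u -> Derive g u = 0.
Proof.
  intros H u Hu. rewrite (Derive_ext_loc g (fun _ => 0)); [apply Derive_const|].
  assert (P : 0 < Rabs u - K) by lra. exists (mkposreal _ P). intros s Hs.
  apply H. change (Rabs (s - u) < Rabs u - K) in Hs.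
  assert (T := Rabs_triang_inv u s). rewrite Rabs_minus_sym in T. lra.
Qed.

Lemma le_of_nonneg_derivative (g g1 : R -> R) t : 0 <= t ->
  (forall s, is_derive g s (g1 s)) -> (forall s, 0 <= s <= t -> 0 <= g1 s) -> g 0 <= g t.
Proof.
  intros Ht H H1. destruct (is_derive_MVT g g1 0 t) as [c [Hc E]]; auto.
  rewrite Rmin_left, Rmax_right in Hc by lra. specialize (H1 c Hc). nra.
Qed.

(* [(w w1)' = w1^2 + q w^2 >= 0], so [w w1] stays positive and [w^2] increases. *)
Lemma linear_solution_ge_1 (q w w1 : R -> R) p t :
  (forall s, is_derive w s (w1 s)) -> (forall s, is_derive w1 s (q s * w s)) ->
  (forall s, 0 <= q s) -> w 0 = 1 -> w1 0 = p -> 0 <= p -> 0 <= t -> 1 <= w t.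
Proof.
  intros Hw Hw1 Hq I0 I1 Hp.
  assert (A : forall s, 0 <= s -> 0 <= w s * w1 s).
  { intros s Hs. apply Rle_trans with (w 0 * w1 0); [rewrite I0, I1; lra|].
    apply (le_of_nonneg_derivative (fun s => w s * w1 s)
      (fun s => w1 s * w1 s + w s * (q s * w s))); auto.
    - intros x. now apply is_derive_mult_R.
    - intros x _. specialize (Hq x).
      assert (0 <= q x * (w x * w x)) by (apply Rmult_le_pos; nra). nra. }
  assert (B : forall s, 0 <= s -> 1 <= w s * w s).
  { intros s Hs. apply Rle_trans with (w 0 * w 0); [rewrite I0; lra|].
    apply (le_of_nonneg_derivative (fun s => w s * w s)
      (fun s => w1 s * w s + w s * w1 s)); auto.
    - intros x. now apply is_derive_mult_R.
    - intros x Hx. specialize (A x (proj1 Hx)). lra. }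
  intros Ht. destruct (Rle_lt_dec 0 (w t)) as [P|N].
  - specialize (B t Ht). nra.
  - destruct (IVT_gen w 0 t 0) as [c [Hc Z]].
    + intros s. eapply continuity_pt_of_is_derive, Hw.
    + rewrite I0. rewrite Rmin_right, Rmax_left; lra.
    + rewrite Rmin_left in Hc by lra. specialize (B c (proj1 Hc)). rewrite Z in B. lra.
Qed.

Lemma exp_le x y : x <= y -> exp x <= exp y.
Proof. intros [H| ->]; [left; now apply exp_increasing|apply Rle_refl]. Qed.

(** The slope is at least [c] everywhere, so [g] overshoots [y] by 1 at distance [K] on either side
    of 0. Mere positivity of the derivative would allow a bounded range. *)
Lemma surjective_of_derive_ge (g : R -> R) c : 0 < c ->
  (forall s, exists l, is_derive g s l /\ c <= l) -> forall y, exists s, g s = y.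
Proof.
  intros Hc H y.
  assert (D : forall s, is_derive g s (Derive g s) /\ c <= Derive g s).
  { intros s. destruct (H s) as [l [Hl Hcl]]. rewrite (is_derive_unique _ _ _ Hl). auto. }
  assert (G : forall a b, a <= b -> c * (b - a) <= g b - g a).
  { intros a b Hab. destruct (is_derive_MVT g (Derive g) a b) as [x [_ E]].
    - intros; apply D.
    - rewrite E. apply Rmult_le_compat_r; [lra|apply D]. }
  set (K := (Rabs (y - g 0) + 1) / c).
  assert (HK : 0 < K) by (apply Rdiv_lt_0_compat; auto; assert (Q := Rabs_pos (y - g 0)); lra).
  assert (E : c * K = Rabs (y - g 0) + 1) by (unfold K; field; lra).
  assert (G1 := G 0 K). assert (G2 := G (- K) 0).
  replace (0 - - K) with K in G2 by ring. rewrite Rminus_0_r in G1.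
  assert (Q1 := Rle_abs (y - g 0)). assert (Q2 := Rle_abs (- (y - g 0))).
  rewrite Rabs_Ropp in Q2.
  destruct (IVT_gen g (- K) K y) as [s [_ Hs]].
  - intros s. eapply continuity_pt_of_is_derive, D.
  - rewrite Rmin_left, Rmax_right by lra. lra.
  - now exists s.
Qed.

(** * The foliation *)

Section Foliation.
Variables (V : R -> R -> R) (m : nat) (A rho : R).
Hypothesis V_smooth : smooth_on (fun _ _ => True) V.
Hypothesis V_far : exists K : R, forall u r, K < Rabs u \/ K < Rabs r -> V u r = 0.
Hypothesis V_hardy : forall u r, 0 < r -> iter_pd (true :: true :: nil) V u r <= / (4 * r ^ 2).
Hypothesis m_pos : (1 <= m)%nat.
Hypothesis rho_pos : 0 < rho.
Hypothesis V_outside : forall u r, rho <= r -> V u r = 0.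

Let p := INR m / 2.
Let Vu := pd true V.
Let Vuu := iter_pd (true :: true :: nil) V.

(* With [r = rho exp (- t)] and [u = A + exp (p t) x], the radial equation in
   dimension [m + 2] becomes [x'' = ef_rhs x t]. *)
Definition ef_rhs (x t : R) : R :=
  p ^ 2 * x + (- rho ^ 2) * exp (- (2 + p) * t) * Vu (A + exp (p * t) * x) (rho * exp (- 1 * t)).

Definition ef_rhs_x (x t : R) : R :=
  p ^ 2 + (- rho ^ 2) * exp (- 2 * t) * Vuu (A + exp (p * t) * x) (rho * exp (- 1 * t)).

Lemma half_le_p : / 2 <= p.
Proof. unfold p. assert (1 <= INR m) by now apply (le_INR 1). lra. Qed.

Lemma ef_rhs_Ck k : Ck everywhere k ef_rhs.
Proof.
  assert (HV := Ck_iter_pd_of_smooth _ _ V_smooth k (true :: nil)).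
  unfold ef_rhs.
  repeat first [apply Ck_plus | apply Ck_mult | apply Ck_exp | apply Ck_const
               | apply Ck_fst | apply Ck_snd].
  apply (Ck_comp everywhere k Vu (fun x t => A + exp (p * t) * x)
    (fun x t => rho * exp (- 1 * t))); auto;
  repeat first [apply Ck_plus | apply Ck_mult | apply Ck_exp | apply Ck_const
               | apply Ck_fst | apply Ck_snd].
Qed.

Lemma ef_rhs_x_Ck k : Ck everywhere k ef_rhs_x.
Proof.
  assert (HV := Ck_iter_pd_of_smooth _ _ V_smooth k (true :: true :: nil)).
  unfold ef_rhs_x.
  repeat first [apply Ck_plus | apply Ck_mult | apply Ck_exp | apply Ck_const
               | apply Ck_fst | apply Ck_snd].
  apply (Ck_comp everywhere k Vuu (fun x t => A + exp (p * t) * x)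
    (fun x t => rho * exp (- 1 * t))); auto;
  repeat first [apply Ck_plus | apply Ck_mult | apply Ck_exp | apply Ck_const
               | apply Ck_fst | apply Ck_snd].
Qed.

Lemma is_derive_ef_rhs x t : is_derive (fun s => ef_rhs s t) x (ef_rhs_x x t).
Proof.
  unfold ef_rhs, ef_rhs_x.
  assert (H : forall u r, is_derive (fun s => Vu s r) u (Vuu u r)).
  { intros u r. apply Derive_correct. apply (V_smooth (true :: nil) u r I). }
  assert (E : exp (- 2 * t) = exp (- (2 + p) * t) * exp (p * t))
    by (rewrite <- exp_plus; f_equal; ring).
  rewrite E. set (r := rho * exp (- 1 * t)).
  auto_derive.
  - eexists. apply H.
  - rewrite (is_derive_unique (fun s => Vu s r) _ _ (H _ r)). ring.
Qed.

(** The support of [V] in [u] reduces the infinite strip to a rectangle. Uniformity in [u] is what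
    makes [ef_rhs] Lipschitz in [x] over the whole line. *)
Lemma Vuu_bounded b : exists B, 0 <= B /\ forall u r, Rabs r <= b -> Rabs (Vuu u r) <= B.
Proof.
  destruct V_far as [K HK].
  assert (Z : forall u r, K < Rabs u -> Vuu u r = 0).
  { intros u r Hu. apply (Derive_vanishing_far (fun t => pd true V t r) K); auto.
    apply (Derive_vanishing_far (fun t => V t r) K). auto. }
  destruct (bounded_on_rectangle Vuu (Rabs K) b) as [B [HB Hb]].
  - intros; apply (V_smooth (true :: true :: nil) x y I).
  - apply Rabs_pos.
  - exists B. split; auto. intros u r Hr.
    destruct (Rle_lt_dec (Rabs u) K) as [l|l].
    + apply Hb; auto. eapply Rle_trans; [exact l|apply Rle_abs].
    + rewrite Z, Rabs_R0; auto.
Qed.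

Lemma ef_rhs_lipschitz : locally_lipschitz_fst ef_rhs.
Proof.
  intros M. destruct (Vuu_bounded (rho * exp M)) as [B [HB Hb]].
  exists (p ^ 2 + rho ^ 2 * exp (2 * M) * B).
  assert (P : 0 <= rho ^ 2 * exp (2 * M)).
  { apply Rmult_le_pos; [apply pow2_ge_0|left; apply exp_pos]. }
  split; [apply Rplus_le_le_0_compat; [apply pow2_ge_0|now apply Rmult_le_pos]|].
  intros x y t Ht. apply Rabs_le_between in Ht.
  destruct (is_derive_MVT (fun s => ef_rhs s t) (fun s => ef_rhs_x s t) y x) as [c [_ E]].
  { intros; apply is_derive_ef_rhs. }
  simpl in E. rewrite E, Rabs_mult. apply Rmult_le_compat_r; [apply Rabs_pos|].
  unfold ef_rhs_x. eapply Rle_trans; [apply Rabs_triang|].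
  rewrite (Rabs_pos_eq (p ^ 2)) by apply pow2_ge_0. apply Rplus_le_compat_l.
  rewrite !Rabs_mult, Rabs_Ropp, (Rabs_pos_eq (rho ^ 2)) by apply pow2_ge_0.
  rewrite (Rabs_pos_eq (exp _)) by (left; apply exp_pos).
  assert (X1 : exp (- 2 * t) <= exp (2 * M)) by (apply exp_le; lra).
  assert (X2 : exp (- 1 * t) <= exp M) by (apply exp_le; lra).
  apply Rmult_le_compat; try apply Rabs_pos.
  - apply Rmult_le_pos; [apply pow2_ge_0|left; apply exp_pos].
  - apply Rmult_le_compat_l; [apply pow2_ge_0|auto].
  - apply Hb. rewrite Rabs_pos_eq.
    + apply Rmult_le_compat_l; lra.
    + apply Rmult_le_pos; [lra|left; apply exp_pos].
Qed.

Lemma Vu_outside u r : rho <= r -> Vu u r = 0.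
Proof.
  intros Hr. unfold Vu, pd. rewrite (Derive_ext _ (fun _ => 0)); [apply Derive_const|].
  intros t. now apply V_outside.
Qed.

Lemma Vuu_outside u r : rho <= r -> Vuu u r = 0.
Proof.
  intros Hr. unfold Vuu. change (Derive (fun t => Vu t r) u = 0).
  rewrite (Derive_ext _ (fun _ => 0)); [apply Derive_const|].
  intros t. now apply Vu_outside.
Qed.

Lemma rho_le_radius t : t <= 0 -> rho <= rho * exp (- 1 * t).
Proof.
  intros Ht. assert (1 <= exp (- 1 * t)) by (rewrite <- exp_0; apply exp_le; lra). nra.
Qed.

Lemma ef_rhs_outside x t : t <= 0 -> ef_rhs x t = p ^ 2 * x.
Proof.
  intros Ht. unfold ef_rhs. rewrite Vu_outside by now apply rho_le_radius. ring.
Qed.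

Lemma ef_rhs_x_outside x t : t <= 0 -> ef_rhs_x x t = p ^ 2.
Proof.
  intros Ht. unfold ef_rhs_x. rewrite Vuu_outside by now apply rho_le_radius. ring.
Qed.

(* Here the bound [1 / (4 r^2)] enters, together with [p >= 1 / 2]. *)
Lemma ef_rhs_x_nonneg x t : 0 <= ef_rhs_x x t.
Proof.
  unfold ef_rhs_x. set (r := rho * exp (- 1 * t)).
  assert (Hr : 0 < r) by (apply Rmult_lt_0_compat; [auto|apply exp_pos]).
  assert (E : - rho ^ 2 * exp (- 2 * t) = - r ^ 2).
  { unfold r. rewrite Rpow_mult_distr. replace (- 2 * t) with (- 1 * t + - 1 * t) by ring.
    rewrite exp_plus. ring. }
  rewrite E. assert (H := V_hardy (A + exp (p * t) * x) r Hr). fold Vuu in H.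
  assert (H' : r ^ 2 * Vuu (A + exp (p * t) * x) r <= r ^ 2 * / (4 * r ^ 2))
    by (apply Rmult_le_compat_l; [apply pow2_ge_0|auto]).
  replace (r ^ 2 * / (4 * r ^ 2)) with (/ 4) in H' by (field; lra).
  assert (Hp := half_le_p). nra.
Qed.

Lemma ef_rhs_continuity x t : continuity_2d_pt ef_rhs x t.
Proof. apply (Ck_continuous _ _ _ x t (ef_rhs_Ck 0) I). Qed.

(** The slope [p * a] selects the mode [exp (p t)] for [t <= 0]; any other slope would mix in
    [exp (- p t)], that is, shift the constant [A]. *)
Let v a := ode_sol ef_rhs a (p * a).
Let z a := ode_dsol ef_rhs a (p * a).

Lemma v_derive a t : is_derive (v a) t (z a t).
Proof. apply is_derive_ode_sol; [apply ef_rhs_continuity|apply ef_rhs_lipschitz]. Qed.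

Lemma z_derive a t : is_derive (z a) t (ef_rhs (v a t) t).
Proof. apply is_derive_ode_dsol; [apply ef_rhs_continuity|apply ef_rhs_lipschitz]. Qed.

Lemma v_at_0 a : v a 0 = a.
Proof. apply ode_sol_0; [apply ef_rhs_continuity|apply ef_rhs_lipschitz]. Qed.

Lemma z_at_0 a : z a 0 = p * a.
Proof. apply ode_dsol_0. Qed.

Lemma exp_scal_derive c t : is_derive (fun s => c * exp (p * s)) t (p * c * exp (p * t)).
Proof. auto_derive; auto. ring. Qed.

Lemma v_outside a t : t <= 0 -> v a t = a * exp (p * t).
Proof.
  intros Ht.
  apply (ode_unique ef_rhs (v a) (z a) (fun s => a * exp (p * s))
    (fun s => p * a * exp (p * s)) 0 t ef_rhs_lipschitz).
  - intros; apply v_derive.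
  - intros; apply z_derive.
  - intros; apply exp_scal_derive.
  - intros s Hs. rewrite Rmin_right, Rmax_left in Hs by lra.
    rewrite ef_rhs_outside by lra.
    replace (p ^ 2 * (a * exp (p * s))) with (p * (p * a) * exp (p * s)) by ring.
    apply exp_scal_derive.
  - rewrite v_at_0, Rmult_0_r, exp_0. ring.
  - rewrite z_at_0, Rmult_0_r, exp_0. ring.
Qed.

Lemma z_outside a t : t < 0 -> z a t = p * a * exp (p * t).
Proof.
  intros Ht. rewrite <- (is_derive_unique _ _ _ (v_derive a t)).
  apply is_derive_unique. apply is_derive_ext_loc with (fun s => a * exp (p * s)).
  - assert (P : 0 < - t) by lra. exists (mkposreal _ P). intros s Hs.
    change (Rabs (s - t) < - t) in Hs. apply Rabs_def2 in Hs.
    symmetry. apply v_outside. lra.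
  - apply exp_scal_derive.
Qed.

(** Joint continuity of [v], which follows from Gronwall before any differentiability is known,
    already makes the coefficient of the linearised equation continuous; so there is no
    circularity. *)
Lemma variation_exists : exists w w1,
  linear_family (fun a t => ef_rhs_x (v a t) t) (fun _ _ => 0) w w1 /\
  (forall a, w a 0 = 1) /\ (forall a, w1 a 0 = p).
Proof.
  apply linear_family_exists; [|intros; apply continuity_2d_pt_const].
  intros a t. apply (continuity_2d_pt_comp ef_rhs_x v (fun _ s => s)).
  - apply (Ck_continuous _ _ _ _ _ (ef_rhs_x_Ck 0) I).
  - apply (flow_continuity_2d ef_rhs v z p ef_rhs_lipschitz v_derive z_derive v_at_0 z_at_0).
  - apply continuity_2d_pt_id2.
Qed.

(** For [t >= 0] the coefficient is nonnegative and [w] stays above 1; for [t < 0], outside the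
    support, [w] is exactly [exp (p t)]. Independence of [a] is what later makes the leaves cover
    everything. *)
Lemma variation_lower_bound w w1 :
  linear_family (fun a t => ef_rhs_x (v a t) t) (fun _ _ => 0) w w1 ->
  (forall a, w a 0 = 1) -> (forall a, w1 a 0 = p) ->
  forall a t, exp (p * Rmin t 0) <= w a t.
Proof.
  intros [Hw Hw1] I0 I1 a t. assert (Hp := half_le_p).
  assert (Hw1' : forall s, is_derive (w1 a) s (ef_rhs_x (v a s) s * w a s)).
  { intros s. specialize (Hw1 a s). now rewrite Rplus_0_r in Hw1. }
  destruct (Rle_lt_dec 0 t) as [l|l].
  - rewrite Rmin_right, Rmult_0_r, exp_0 by lra.
    apply (linear_solution_ge_1 (fun s => ef_rhs_x (v a s) s) (w a) (w1 a) p); auto; [|lra].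
    intros; apply ef_rhs_x_nonneg.
  - rewrite Rmin_left by lra. right. symmetry.
    apply (ode_unique (fun x s => p ^ 2 * x + 0) (w a) (w1 a)
      (fun s => exp (p * s)) (fun s => p * exp (p * s)) 0 t).
    + apply (linear_rhs_lipschitz (fun _ _ => p ^ 2) (fun _ _ => 0) 0).
      intros; apply continuity_2d_pt_const.
    + intros; apply Hw.
    + intros s Hs. rewrite Rmin_right, Rmax_left in Hs by lra.
      specialize (Hw1 a s). simpl in Hw1. rewrite ef_rhs_x_outside in Hw1 by lra. exact Hw1.
    + intros; auto_derive; auto. ring.
    + intros; auto_derive; auto. ring.
    + rewrite I0, Rmult_0_r, exp_0. ring.
    + rewrite I1, Rmult_0_r, exp_0. ring.
Qed.

(** * The leaves in the radial variable *)

Definition log_radius (r : R) : R := ln rho + - 1 * ln r.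

Definition foliation (s r : R) : R := A + exp (p * log_radius r) * v s (log_radius r).

Lemma exp_log_radius r : 0 < r -> rho * exp (- 1 * log_radius r) = r.
Proof.
  intros Hr. unfold log_radius.
  replace (- 1 * (ln rho + - 1 * ln r)) with (ln r + - ln rho) by ring.
  rewrite exp_plus, exp_Ropp, !exp_ln by auto. field. lra.
Qed.

Lemma exp_2p_log_radius r : 0 < r ->
  exp (p * log_radius r) * exp (p * log_radius r) = rho ^ m / r ^ m.
Proof.
  intros Hr. rewrite <- exp_plus.
  replace (p * log_radius r + p * log_radius r) with (INR m * ln rho + - (INR m * ln r))
    by (unfold p, log_radius; field).
  rewrite exp_plus, exp_Ropp.
  change (Rpower rho (INR m) * / Rpower r (INR m) = rho ^ m / r ^ m).
  rewrite !Rpower_pow by auto. reflexivity.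
Qed.

Lemma foliation_smooth : smooth_on (fun _ r => 0 < r) foliation.
Proof.
  apply smooth_of_Ck; [apply open_2d_right_half|]. intros k.
  destruct variation_exists as (w & w1 & Hw & I0 & I1).
  destruct (flow_Ck ef_rhs ef_rhs_x v z w w1 p ef_rhs_Ck ef_rhs_x_Ck is_derive_ef_rhs
    ef_rhs_lipschitz v_derive z_derive v_at_0 z_at_0 Hw I0 I1 k) as [Cv _].
  assert (L : Ck (fun _ r => 0 < r) k (fun _ r => log_radius r)).
  { apply Ck_plus; [apply Ck_const|]. apply Ck_mult; [apply Ck_const|apply Ck_ln_snd]. }
  apply Ck_plus; [apply Ck_const|]. apply Ck_mult.
  - apply Ck_exp, Ck_mult; [apply Ck_const|auto].
  - apply (Ck_comp _ k v (fun s _ => s) (fun _ r => log_radius r)); auto. apply Ck_fst.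
Qed.

Lemma foliation_transverse r : exists c, 0 < c /\ forall s, exists l,
  is_derive (fun s => foliation s r) s l /\ c <= l.
Proof.
  destruct variation_exists as (w & w1 & Hw & I0 & I1).
  assert (B := variation_lower_bound w w1 Hw I0 I1).
  set (t := log_radius r).
  assert (P1 := exp_pos (p * t)). assert (P2 := exp_pos (p * Rmin t 0)).
  exists (exp (p * t) * exp (p * Rmin t 0)). split; [now apply Rmult_lt_0_compat|].
  intros s. exists (exp (p * t) * w s t). split; [|apply Rmult_le_compat_l; auto; lra].
  unfold foliation. fold t.
  destruct (flow_derive ef_rhs ef_rhs_x v z w w1 p ef_rhs_x_Ck is_derive_ef_rhs
    ef_rhs_lipschitz v_derive z_derive v_at_0 z_at_0 Hw I0 I1 s t) as [D _].
  rewrite <- (Rplus_0_l (exp (p * t) * w s t)). apply (is_derive_plus (fun _ => A)).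
  - apply (is_derive_const (K := R_AbsRing) (V := R_NormedModule)).
  - now apply (is_derive_scal (fun x => v x t)).
Qed.

Lemma foliation_increasing r s1 s2 : s1 < s2 -> foliation s1 r < foliation s2 r.
Proof.
  intros Hs. destruct (foliation_transverse r) as [c [Hc H]].
  destruct (is_derive_MVT (fun s => foliation s r) (Derive (fun s => foliation s r)) s1 s2)
    as [x [_ E]].
  - intros s _. destruct (H s) as [l [Hl _]]. apply Derive_correct. now exists l.
  - destruct (H x) as [l [Hl Hcl]].
    assert (Dl : Derive (fun s : R => foliation s r) x = l) by now apply is_derive_unique.
    cbv beta in E. rewrite Dl in E.
    assert (0 < l * (s2 - s1)) by (apply Rmult_lt_0_compat; lra). lra.
Qed.

Lemma foliation_radial_solution s r : 0 < r ->
  ex_derive (foliation s) r /\ ex_derive (Derive (foliation s)) r /\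
  Derive (Derive (foliation s)) r + (INR m + 1) / r * Derive (foliation s) r
    + Vu (foliation s r) r = 0.
Proof.
  set (u1 := fun r => - / r * exp (p * log_radius r)
                      * (p * v s (log_radius r) + z s (log_radius r))).
  set (u2 := fun r => / r ^ 2 * exp (p * log_radius r)
                * ((p + 1) * (p * v s (log_radius r) + z s (log_radius r))
                   + p * z s (log_radius r) + ef_rhs (v s (log_radius r)) (log_radius r))).
  assert (Dl : forall r, 0 < r -> is_derive log_radius r (- / r)).
  { intros x Hx. unfold log_radius. auto_derive; auto. field. lra. }
  assert (Dv : forall r, 0 < r -> is_derive (fun r => v s (log_radius r)) r
     (- / r * z s (log_radius r))).
  { intros x Hx. apply (is_derive_comp (v s) log_radius); auto. apply v_derive. }
  assert (Dz : forall r, 0 < r -> is_derive (fun r => z s (log_radius r)) r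
     (- / r * ef_rhs (v s (log_radius r)) (log_radius r))).
  { intros x Hx. apply (is_derive_comp (z s) log_radius); auto. apply z_derive. }
  assert (De : forall r, 0 < r -> is_derive (fun r => exp (p * log_radius r)) r
     (- / r * p * exp (p * log_radius r))).
  { intros x Hx. rewrite (Rmult_comm (- / x) p).
    apply (is_derive_comp exp (fun x => p * log_radius x)); [apply is_derive_exp|].
    apply (is_derive_scal log_radius); auto. }
  assert (D1 : forall r, 0 < r -> is_derive (foliation s) r (u1 r)).
  { intros x Hx. unfold foliation.
    replace (u1 x) with (0 + (- / x * p * exp (p * log_radius x) * v s (log_radius x)
       + exp (p * log_radius x) * (- / x * z s (log_radius x)))) by (unfold u1; ring).
    apply (is_derive_plus (fun _ => A)).
    - apply (is_derive_const (K := R_AbsRing) (V := R_NormedModule)).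
    - apply (is_derive_mult_R (fun x => exp (p * log_radius x))
        (fun x => v s (log_radius x))); auto. }
  assert (D2 : forall r, 0 < r -> is_derive u1 r (u2 r)).
  { intros x Hx. specialize (De x Hx). specialize (Dv x Hx). specialize (Dz x Hx). unfold u1.
    replace (u2 x) with
     ((/ x ^ 2 * exp (p * log_radius x) + - / x * (- / x * p * exp (p * log_radius x)))
        * (p * v s (log_radius x) + z s (log_radius x))
      + (- / x * exp (p * log_radius x)) * (p * (- / x * z s (log_radius x))
           + - / x * ef_rhs (v s (log_radius x)) (log_radius x)))
      by (unfold u2; field; lra).
    apply (is_derive_mult_R (fun x => - / x * exp (p * log_radius x))
      (fun x => p * v s (log_radius x) + z s (log_radius x))).
    - apply (is_derive_mult_R (fun x => - / x) (fun x => exp (p * log_radius x))); auto.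
      auto_derive; [lra|]. field. lra.
    - apply (is_derive_plus (fun x => p * v s (log_radius x)) (fun x => z s (log_radius x))); auto.
      apply (is_derive_scal (fun x => v s (log_radius x))); auto. }
  intros Hr.
  (* [Derive (foliation s)] is known to equal [u1] only at positive radii, hence the ball of radius
     [r] around [r]. *)
  assert (D2' : is_derive (Derive (foliation s)) r (u2 r)).
  { apply is_derive_ext_loc with u1; [|auto].
    exists (mkposreal r Hr). intros x Hx. change (Rabs (x - r) < r) in Hx.
    apply Rabs_def2 in Hx. symmetry. apply is_derive_unique, D1. lra. }
  split; [eexists; apply D1; auto|]. split; [eexists; apply D2'|].
  rewrite (is_derive_unique _ _ _ D2'), (is_derive_unique _ _ _ (D1 r Hr)).
  (* Since [INR m = 2 p], the terms in [z] cancel and [exp (p t) * (ef_rhs - p^2 v) / r^2] remains,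
     which is [- Vu] because [rho * exp (- t) = r]. *)
  unfold u1, u2, ef_rhs. fold (foliation s r). rewrite exp_log_radius by auto.
  set (t := log_radius r). set (F := Vu (foliation s r) r).
  replace (- (2 + p) * t) with (- 1 * t + (- 1 * t + - (p * t))) by ring.
  rewrite !exp_plus, exp_Ropp.
  assert (Hrr : exp (- 1 * t) = r / rho).
  { assert (E := exp_log_radius r Hr). fold t in E.
    apply (Rmult_eq_reg_l rho); [|lra]. rewrite E. field. lra. }
  rewrite Hrr. replace (INR m) with (2 * p) by (unfold p; field).
  assert (P := exp_pos (p * t)). field. lra.
Qed.

(** One factor [exp (p t)] comes from the change of unknown and one from the mode [v_outside]; their
    product is [(rho / r)^m], whence the coefficient [s * rho^m]. *)
Lemma foliation_tail s r : rho < r -> foliation s r = s * rho ^ m / r ^ m + A.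
Proof.
  intros Hr. unfold foliation. rewrite v_outside.
  - replace (exp (p * log_radius r) * (s * exp (p * log_radius r))) with
      (s * (exp (p * log_radius r) * exp (p * log_radius r))) by ring.
    rewrite exp_2p_log_radius by lra. field. apply pow_nonzero. lra.
  - unfold log_radius. assert (ln rho < ln r) by now apply ln_increasing. lra.
Qed.

(** The inverse substitution turns [u] into a solution [x] of the same equation as [v s]. The two
    agree to first order at one time far out in the tail, so uniqueness identifies them at all
    radii. *)
Lemma foliation_complete (u : R -> R) alpha R0 :
  (forall r, 0 < r -> ex_derive u r /\ ex_derive (Derive u) r /\
     Derive (Derive u) r + (INR m + 1) / r * Derive u r + Vu (u r) r = 0) ->
  (forall r, R0 < r -> u r = alpha / r ^ m + A) ->
  forall r, 0 < r -> u r = foliation (alpha / rho ^ m) r.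
Proof.
  intros Hu Htail r Hr.
  set (s := alpha / rho ^ m).
  set (x := fun t => exp (- p * t) * (u (rho * exp (- 1 * t)) - A)).
  set (x1 := fun t => exp (- p * t) * (- p * (u (rho * exp (- 1 * t)) - A)
               - rho * exp (- 1 * t) * Derive u (rho * exp (- 1 * t)))).
  assert (Pr : forall t, 0 < rho * exp (- 1 * t))
    by (intros; apply Rmult_lt_0_compat; [auto|apply exp_pos]).
  assert (Dx : forall t, is_derive x t (x1 t)).
  { intros t. destruct (Hu _ (Pr t)) as (U1 & _). unfold x, x1.
    auto_derive; [auto|]. change (Derive (fun x => u x)) with (Derive u). ring. }
  assert (Dx1 : forall t, is_derive x1 t (ef_rhs (x t) t)).
  { intros t. destruct (Hu _ (Pr t)) as (U1 & U2 & U3). unfold x1.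
    auto_derive; [auto|].
    change (Derive (fun x => u x)) with (Derive u).
    change (Derive (fun x => Derive u x)) with (Derive (Derive u)).
    unfold ef_rhs, x.
    replace (A + exp (p * t) * (exp (- p * t) * (u (rho * exp (- 1 * t)) - A)))
      with (u (rho * exp (- 1 * t))).
    2: { rewrite <- Rmult_assoc, <- exp_plus. replace (p * t + - p * t) with 0 by ring.
         rewrite exp_0. ring. }
    replace (- (2 + p) * t) with (- 1 * t + (- 1 * t + - p * t)) by ring.
    rewrite !exp_plus. specialize (Pr t).
    set (e := exp (- 1 * t)) in *. set (E := exp (- p * t)).
    set (d1 := Derive u (rho * e)) in *. set (d2 := Derive (Derive u) (rho * e)) in *.
    set (W := Vu (u (rho * e)) (rho * e)) in *.
    replace W with (- d2 - (INR m + 1) / (rho * e) * d1) by lra.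
    replace (INR m) with (2 * p) by (unfold p; field).
    assert (Pe : 0 < e) by apply exp_pos. field. repeat split; lra. }
  (* A radius beyond both the support and [R0]. Strictly beyond, since [x'] and [z] are read off the
     explicit exponential on a neighbourhood of [t0]. *)
  set (rb := Rabs R0 + rho + 1).
  assert (Hrb : rho < rb) by (unfold rb; assert (Q := Rabs_pos R0); lra).
  set (t0 := log_radius rb).
  assert (Ht0 : t0 < 0).
  { unfold t0, log_radius. assert (ln rho < ln rb) by now apply ln_increasing. lra. }
  assert (Tail : forall t, R0 < rho * exp (- 1 * t) -> x t = s * exp (p * t)).
  { intros t Ht. unfold x, s. rewrite Htail by auto.
    rewrite Rpow_mult_distr.
    assert (E : exp (- 1 * t) ^ m = exp (- p * t) * exp (- p * t)).
    { rewrite <- Rpower_pow by apply exp_pos. unfold Rpower. rewrite ln_exp, <- exp_plus.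
      f_equal. unfold p. field. }
    rewrite E. replace (- p * t) with (- (p * t)) by ring. rewrite exp_Ropp.
    assert (P := exp_pos (p * t)). assert (rho ^ m <> 0) by (apply pow_nonzero; lra).
    field. lra. }
  assert (Hrad : rho * exp (- 1 * t0) = rb) by (apply exp_log_radius; lra).
  assert (Bt0 : R0 < rho * exp (- 1 * t0)).
  { rewrite Hrad. unfold rb. assert (Q := Rle_abs R0). lra. }
  assert (X0 : x t0 = v s t0) by (rewrite v_outside by lra; now apply Tail).
  assert (X1 : x1 t0 = z s t0).
  { rewrite z_outside by lra. rewrite <- (is_derive_unique _ _ _ (Dx t0)).
    apply is_derive_unique. apply is_derive_ext_loc with (fun t => s * exp (p * t)).
    - assert (C : continuity_pt (fun t => rho * exp (- 1 * t)) t0).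
      { apply continuity_pt_of_is_derive with (- (rho * exp (- 1 * t0))).
        auto_derive; auto. ring. }
      destruct (C (rho * exp (- 1 * t0) - R0)) as [d [Pd Hd]]; [lra|].
      exists (mkposreal d Pd). intros t Ht. change (Rabs (t - t0) < d) in Ht.
      symmetry. apply Tail. destruct (Req_dec t t0) as [->|N]; auto.
      assert (Q : Rabs (rho * exp (- 1 * t) - rho * exp (- 1 * t0)) < rho * exp (- 1 * t0) - R0)
        by (apply Hd; split; [split; auto; exact I|exact Ht]).
      apply Rabs_def2 in Q. lra.
    - apply exp_scal_derive. }
  assert (Eq : x (log_radius r) = v s (log_radius r)).
  { apply (ode_unique ef_rhs x x1 (v s) (z s) t0); auto using ef_rhs_lipschitz;
      intros; [apply v_derive|apply z_derive]. }
  unfold foliation. rewrite <- Eq. unfold x. rewrite exp_log_radius by auto.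
  rewrite <- Rmult_assoc, <- exp_plus.
  replace (p * log_radius r + - p * log_radius r) with 0 by ring. rewrite exp_0. ring.
Qed.

End Foliation.

Theorem theorem3 (n : nat) (V : R -> R -> R) :
  (3 <= n)%nat ->
  admissible_potential V ->
  (forall u r, 0 < r -> iter_pd (true :: true :: nil) V u r <= / (4 * r ^ 2)) ->
  forall A : R,
    (* N_A is totally ordered *)
    (forall u1 u2, N_set n V A u1 -> N_set n V A u2 ->
       (exists r, 0 < r /\ u1 r <> u2 r) ->
       (forall r, 0 < r -> u1 r < u2 r) \/ (forall r, 0 < r -> u2 r < u1 r)) /\
    (* the graphs of N_A form a smooth foliation of R^{n+1} minus the u-axis:
       N_A is exactly a family (Phi s)_{s in R} with Phi smooth on
       R x (0,oo), d_s Phi > 0, and s |-> Phi s r onto R for each r > 0 *)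
    (exists Phi : R -> R -> R,
       smooth_on (fun _ r => 0 < r) Phi /\
       (forall s r, 0 < r -> 0 < pd true Phi s r) /\
       (forall r y, 0 < r -> exists s, Phi s r = y) /\
       (forall s, N_set n V A (Phi s)) /\
       (forall u, N_set n V A u -> exists s, forall r, 0 < r -> u r = Phi s r)).
Proof.
  intros Hn (V_smooth & _ & V_far) V_hardy A.
  set (m := (n - 2)%nat). assert (Hm : (1 <= m)%nat) by lia.
  assert (Hnm : INR n - 1 = INR m + 1).
  { replace n with (S (S m)) by lia. rewrite !S_INR. ring. }
  assert (Hrho : exists rho, 0 < rho /\ forall u r, rho <= r -> V u r = 0).
  { destruct V_far as [K HK]. exists (Rmax K 0 + 1).
    assert (Q1 := Rmax_l K 0). assert (Q2 := Rmax_r K 0). split; [lra|].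
    intros u r Hr. apply HK. right. assert (Q := Rle_abs r). lra. }
  destruct Hrho as (rho & Prho & Vout).
  assert (All : forall u, N_set n V A u ->
            exists s, forall r, 0 < r -> u r = foliation V m A rho s r).
  { intros u [Hsol (alpha & R0 & Htail)]. exists (alpha / rho ^ m).
    apply foliation_complete with R0; auto.
    intros r Hr. rewrite <- Hnm. now apply Hsol. }
  assert (Incr := foliation_increasing V m A rho V_smooth V_far V_hardy Hm Prho Vout).
  split.
  - intros u1 u2 H1 H2 (r0 & Hr0 & Hne).
    destruct (All u1 H1) as [s1 E1], (All u2 H2) as [s2 E2].
    (* The order on [N_A] is the order of the leaf parameters; equal parameters are excluded by the
       radius where the two solutions differ. *)
    destruct (Rtotal_order s1 s2) as [l|[e|l]].
    + left. intros r Hr. rewrite E1, E2 by auto. now apply Incr.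
    + exfalso. apply Hne. now rewrite E1, E2, e.
    + right. intros r Hr. rewrite E1, E2 by auto. now apply Incr.
  - exists (foliation V m A rho). split; [|split; [|split; [|split]]]; auto.
    + apply foliation_smooth; auto.
    + intros s r _.
      destruct (foliation_transverse V m A rho V_smooth V_far V_hardy Hm Prho Vout r)
        as [c [Hc H]].
      destruct (H s) as [l [Hl Hcl]].
      change (0 < Derive (fun s : R => foliation V m A rho s r) s).
      replace (Derive (fun s : R => foliation V m A rho s r) s) with l
        by (symmetry; now apply is_derive_unique). lra.
    + intros r y _.
      destruct (foliation_transverse V m A rho V_smooth V_far V_hardy Hm Prho Vout r)
        as [c [Hc H]].
      now apply (surjective_of_derive_ge (fun s => foliation V m A rho s r) c).
    + intros s. split.
      * intros r Hr. rewrite Hnm. apply foliation_radial_solution; auto.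
      * exists (s * rho ^ m), rho. apply foliation_tail; auto.
Qed.
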